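(* Let $b,q$ be integers with $2\le q<b$, and let $D=\{0=d_0,d_1,\dots,d_{q-1}\}\subset\mathbb{Z}$ be a set of cardinality $q$ such that there exists $L\subset\mathbb{Z}$ for which $(b,D,L)$ is a Hadamard triple. Let $\mu=\mu_{b,D}$ be the self-similar Borel probability measure on $\mathbb{R}$ satisfying $$\mu(\cdot)=\frac1q\sum_{j=0}^{q-1}\mu\big(b(\cdot)-d_j\big).$$ Then for any $t\in\left(0,\frac{\log q}{\log b}\right)$ and any $s\in[0,\infty]$, there exists a spectrum $\Lambda=\Lambda_{t,s}$ of $\mu$ such that $$\dim_{Be}(\Lambda)=t\quad\text{and}\quad D_t^+(\Lambda)=s.$$
   Context: Hadamard triple: for $b\in\mathbb{Z}$ and finite sets $D,L\subset\mathbb{Z}$ with $\#D=\#L=q$, $(b,D,L)$ is a Hadamard triple if the $q\times q$ matrix $\frac{1}{\sqrt q}\left(e^{2\pi i d\ell/b}\right)_{d\in D,\,\ell\in L}$ is unitary. The measure $\mu_{b,D}$ is the unique Borel probability measure with compact support satisfying the displayed identity. Equivalently, it is the infinite convolution $\delta_{b^{-1}D}*\delta_{b^{-2}D}*\cdots$ (weak limit), where $\delta_E=\frac{1}{\#E}\sum_{e\in E}\delta_e$ for a finite set $E$. Spectrum: a countable set $\Lambda\subset\mathbb{R}$ is a spectrum of $\mu$ if $\{e^{2\pi i\lambda x}:\lambda\in\Lambda\}$ is an orthonormal basis of $L^2(\mu)$. Beurling density and dimension: for a countable set $\Lambda\subset\mathbb{R}$ and $r\ge0$, the (upper) $r$-Beurling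 density is $$D_r^+(\Lambda)=\limsup_{h\to\infty}\sup_{x\in\mathbb{R}}\frac{\#\big(\Lambda\cap(x-h,x+h)\big)}{h^r}\in[0,\infty],$$ and the Beurling dimension is $\dim_{Be}(\Lambda)=\inf\{r:D_r^+(\Lambda)=0\}=\sup\{r:D_r^+(\Lambda)=\infty\}$. *)

(* Defs.v *)
From HB Require Import structures.
From mathcomp Require Import all_boot all_order all_algebra finmap.
From mathcomp Require Import all_classical all_reals all_analysis.
From mathcomp Require Import complex.

Set Implicit Arguments.
Unset Strict Implicit.
Unset Printing Implicit Defensive.
Import Order.TTheory GRing.Theory Num.Theory.
Import numFieldNormedType.Exports.

Local Open Scope classical_set_scope.
Local Open Scope ring_scope.
Local Open Scope complex_scope.

Definition expi2pi (R : realType) (x : R) : R[i] :=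
  cos (2 * pi * x) +i* sin (2 * pi * x).

(* Rows and columns are listed in the order of the enumerations of D and L;
   unitarity does not depend on that order. *)
Definition hadamard_matrix (R : realType) (b : int) (q : nat)
    (D L : {fset int}) : 'M[R[i]]_q :=
  \matrix_(i < q, j < q)
    (((Num.sqrt q%:R)^-1)%:C
     * expi2pi ((nth 0 (enum_fset D) i)%:~R * (nth 0 (enum_fset L) j)%:~R
                / b%:~R)).

Definition hadamard_triple (R : realType) (b : int) (D L : {fset int}) : Prop :=
  exists q : nat, [/\ #|` D|%fset = q, #|` L|%fset = q &
    hadamard_matrix R b q D L \is unitarymx].

Definition self_similar_measure (R : realType) (b : int) (D : {fset int})
    (mu : probability (measurableTypeR R) R) : Prop :=
  (exists K : set R, compact K /\ mu K = 1%E) /\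
  forall A : set (measurableTypeR R), measurable A ->
    mu A = ((#|` D|%fset%:R^-1)%:E *
      \sum_(d <- enum_fset D) mu [set (b%:~R * x - d%:~R)%R | x in A])%E.

Section SquareIntegrable.
Context (R : realType) (mu : probability (measurableTypeR R) R).
Implicit Types f g : measurableTypeR R -> R[i].

Definition complex_L2 f : Prop :=
  (fun x => complex.Re (f x)) \in Lfun mu 2%:E /\
  (fun x => complex.Im (f x)) \in Lfun mu 2%:E.

Definition L2_norm f : \bar R :=
  Lnorm mu 2%:E (fun x => (ComplexField.Normc.normc (f x))%:E).

Definition L2_inner f g : R[i] :=
  (\int[mu]_x complex.Re (f x * (g x)^*)) +i*
  (\int[mu]_x complex.Im (f x * (g x)^*)).

Definition exponential (l : R) : measurableTypeR R -> R[i] :=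
  fun x => expi2pi (l * x).

Definition orthonormal_exponentials (Lambda : set R) : Prop :=
  forall l m : R, Lambda l -> Lambda m ->
    L2_inner (exponential l) (exponential m) = (l == m)%:R.

Definition total_exponentials (Lambda : set R) : Prop :=
  forall f, complex_L2 f -> forall eps : R, 0 < eps ->
    exists (s : seq R) (c : R -> R[i]),
      (forall l, l \in s -> Lambda l) /\
      (L2_norm (fun x => f x - \sum_(l <- s) c l * exponential l x)%R
        < eps%:E)%E.

Definition is_spectrum (Lambda : set R) : Prop :=
  [/\ countable Lambda, orthonormal_exponentials Lambda &
      total_exponentials Lambda].

End SquareIntegrable.

(* [counting] takes the value +oo on infinite sets. *)
Definition upper_beurling_density (R : realType) (r : R) (Lambda : set R)
    : \bar R :=
  limf_esup (fun h : R =>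
    ereal_sup [set (counting (Lambda `&` [set` `]x - h, x + h[%R])
                    * ((h `^ r)^-1)%:E)%E | x in [set: R]])
    (pinfty_nbhs R).

Definition beurling_dim (R : realType) (Lambda : set R) : \bar R :=
  ereal_inf
    [set r%:E | r in [set r : R | 0 <= r
                      /\ upper_beurling_density r Lambda = 0%E]].

(* Main.v *)
Require Import Defs.
From HB Require Import structures.
From mathcomp Require Import all_boot all_order all_algebra finmap.
From mathcomp Require Import all_classical all_reals all_analysis.
From mathcomp Require Import complex ring lra measurable_realfun.
Set Implicit Arguments.
Unset Strict Implicit.
Unset Printing Implicit Defensive.
Import Order.TTheory GRing.Theory Num.Theory.
Import numFieldNormedType.Exports HBSimple HBNNSimple.
Local Open Scope classical_set_scope.
Local Open Scope ring_scope.

(** Let [phi] be the squared modulus of the Fourier transform of the measure, and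
    [M] that of the uniform measure on the digits.  Self-similarity reads
    [phi x = M (x / b) * phi (x / b)], so that [phi] is an infinite product of
    dilates of [M].  A set of [q ^ m] frequencies is a spectrum of the
    convolution of the first [m] factors of the measure when the products of the
    first [m] dilates of [M], evaluated at [x + l], sum to one.  Such a set can
    be refined to the level [m + p]: each frequency [l] is replaced by the
    [l + b ^ m * l'], where [l'] runs over a spectrum of the [p] following
    factors, and each of these points can be displaced by its own element of
    [b ^ (m + p) * Gam], where [Gam] is the group of periods of [M]
    ([level_spectrum_ext]).  This freedom is used for two purposes.

    Completeness.  The union of an increasing sequence of such sets is
    orthogonal, but the sum of [phi (x + l)] over it can be less than one.  It
    is one if [phi] is bounded below by a fixed [e > 0] near the new points of
    each level, divided by [b ^ (m + p)]: then the Parseval sum grows by a fixed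
    amount at each step as long as it has not come close to one ([rs_gain],
    [rs_parseval]).  Periods that achieve this lower bound exist, and some of
    them lie arbitrarily far away ([far_positivity]).  The reason is that no
    point has all its translates by [Gam] among the zeros of [phi]
    ([exists_phi_neq0]) and that [phi a > 0] for some period [a > 0]
    ([exists_period_phi_gt0]).

    Density.  In one step there are [q ^ p] points above the frequency [0], and
    without large displacements they fit in an interval of length comparable to
    [b ^ (m + p)].  As [b `^ t < q], this is more than any density of exponent
    [t] allows.  Keeping together only part of them, added one by one until the
    density [c] is reached ([density_prefix]), and scattering all other points
    to huge mutual distances, one obtains a step whose largest density is [c]
    ([exists_refinement]).  Taking [c] constant and equal to [s] gives the
    density [s]; targets that tend to [0] or to infinity give the two extreme
    values, and if they do so at most linearly in the number of steps, while the
    scales grow exponentially, the dimension remains [t] ([exists_targets],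
    [beurling_dim_profile]).

    It remains to see that the Parseval identity makes the exponentials total.
    It puts every exponential, hence every trigonometric polynomial, in the
    closed span of the family ([in_closure_exp_sum]).  Since the measure is
    carried by a bounded interval, indicators of half lines are limits of
    uniformly bounded trigonometric polynomials ([half_line_closure]); Borel
    sets, simple functions and square integrable functions follow. *)

(** * Counting points in intervals *)

Section IntervalCounting.
Context (R : realType).
Implicit Types (x h u : R) (s : seq R).

Definition count_in x h s := count (fun y : R => x - h < y < x + h) s.

Lemma count_in_sub x h s1 s2 : uniq s1 ->
  (forall y, y \in s1 -> x - h < y < x + h -> y \in s2) ->
  (count_in x h s1 <= count_in x h s2)%N.
Proof.
move=> u12 s12; rewrite /count_in -!size_filter; apply: uniq_leq_size.
  exact: filter_uniq.
by move=> y; rewrite !mem_filter => /andP[yI ys]; rewrite yI s12.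
Qed.

Lemma window_dist_lt x h h' (y z : R) : h <= h' -> x - h < y < x + h ->
  x - h < z < x + h -> `|y - z| < 2 * h'.
Proof. by rewrite ltr_norml; lra. Qed.

Lemma count_in_size x h s : (count_in x h s <= size s)%N.
Proof. exact: count_size. Qed.

Lemma count_in_le1 x h s : uniq s ->
  (forall y z, y \in s -> z \in s -> y != z -> x - h < y < x + h ->
    x - h < z < x + h -> 2 * h <= `|y - z|) ->
  (count_in x h s <= 1)%N.
Proof.
move=> us sep; rewrite /count_in -size_filter.
set t := seq.filter _ _; have ut : uniq t by exact: filter_uniq.
have tP y : y \in t -> (x - h < y < x + h) /\ y \in s.
  by rewrite mem_filter => /andP[].
case: t ut tP => [//|y [//|z t]] /= /andP[] + _ tP.
rewrite inE negb_or => /andP[yz _].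
have [yI ys] := tP y (mem_head _ _).
have [|zI zs] := tP z; first by rewrite !inE eqxx orbT.
have := sep _ _ ys zs yz yI zI; rewrite leNgt => /negP[].
rewrite ltr_norml; lra.
Qed.

Lemma count_in_shift x h u s :
  count_in x h [seq y + u | y <- s] = count_in (x - u) h s.
Proof.
rewrite /count_in count_map; apply: eq_count => y /=.
by apply/idP/idP; lra.
Qed.

Lemma count_in_takeS x h k s :
  (count_in x h (take k.+1 s) <= (count_in x h (take k s)).+1)%N.
Proof.
rewrite /count_in; elim: s k => [//|y s IH] [|k] /=.
  by rewrite take0 addn0; case: (_ < _ < _).
by rewrite -addnS leq_add2l.
Qed.

(** A discrete intermediate value theorem: adding one point at a time raises a
    count by at most one, so the first prefix that attains the density
    [c * h `^ t] on some interval does not exceed it by more than one point. *)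
Lemma density_prefix s (c t h0 : R) : 0 < c -> 0 < h0 ->
  (exists x h, h0 <= h /\ c * h `^ t <= (count_in x h s)%:R) ->
  exists k,
    (exists x h, h0 <= h /\ c * h `^ t <= (count_in x h (take k s))%:R) /\
    (forall x h, h0 <= h -> (count_in x h (take k s))%:R <= c * h `^ t + 1).
Proof.
move=> c0 h00 full.
pose P k := `[< exists x h, h0 <= h /\ c * h `^ t <= (count_in x h (take k s))%:R >].
have exP : exists k, P k by exists (size s); apply/asboolP; rewrite take_size.
exists (ex_minn exP); case: ex_minnP => -[|k] /asboolP Pk kmin; split => //.
  case: Pk => [x [h [hh]]]; rewrite take0 /count_in /= leNgt.
  by rewrite mulr_gt0 // powR_gt0 // (lt_le_trans h00).
move=> x h hh; have : ~~ P k by apply/negP => /kmin; rewrite ltnn.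
move=> /asboolPn nP; apply: (@le_trans _ _ (count_in x h (take k s)).+1%:R).
  by rewrite ler_nat count_in_takeS.
rewrite -natr1 lerD2r leNgt; apply/negP => lt; apply: nP.
by exists x, h; split => //; exact: ltW.
Qed.

End IntervalCounting.

(** Growth of the counting functions of an increasing sequence of finite sets
    that is prescribed by the targets [c j]: up to a negligible part, an
    interval of half length [r] holds at most about [c j * r `^ t] points, for
    an index [j] that is large when [r] is, and each target is attained at some
    scale beyond [kap * 2 ^+ j]. *)
Record density_profile (R : realType) (t : R) (c : nat -> R) (kap : R)
    (Lam : nat -> seq R) : Prop := {
  dp_sub : forall i j, (i <= j)%N -> {subset Lam i <= Lam j};
  dp_uniq : forall n, uniq (Lam n);
  dp_upper : forall J, exists r0, forall r x n, r0 <= r ->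
    (count_in x r (Lam n))%:R <= r `^ t / J.+1%:R + 1 \/
    exists j, [/\ (J <= j)%N, kap * 2 ^+ j <= r &
      (count_in x r (Lam n))%:R <= c j * r `^ t + 1];
  dp_lower : forall j, exists n x r, kap * 2 ^+ j <= r /\
    c j * r `^ t <= (count_in x r (Lam n))%:R
}.

(** * Geometric and power growth *)

Lemma linear_le_geometric (R : realType) (sig : R) j : 1 < sig ->
  j.+1%:R * (sig - 1) <= sig ^+ j.+1.
Proof.
move=> sig1; elim: j => [|j IH]; first by rewrite mul1r expr1; lra.
rewrite [sig ^+ j.+2]exprS -[j.+2%:R]natr1 mulrDl mul1r.
have P1 : 1 <= sig ^+ j.+1 by apply: exprn_ege1; lra.
have : 0 <= (sig - 1) * (sig ^+ j.+1 - 1) by rewrite mulr_ge0 ?subr_ge0 // ltW.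
by lra.
Qed.

Lemma cvg_natmul_geometric (R : realType) (z : R) : 0 <= z < 1 ->
  n.+1%:R * z ^+ n.+1 @[n --> \oo] --> (0 : R).
Proof.
move=> /andP[z0 z1]; pose sig := 2 / (1 + z).
have z1' : 0 < 1 + z by lra.
have sig1 : 1 < sig by rewrite /sig ltr_pdivlMr //; lra.
have sz : sig * z < 1 by rewrite /sig mulrAC ltr_pdivrMr //; lra.
have sz0 : 0 <= sig * z by rewrite mulr_ge0 // ltW // (lt_trans ltr01).
have s10 : 0 < sig - 1 by lra.
have lim : (sig - 1)^-1 * (sig * z) ^+ n.+1 @[n --> \oo] --> (0 : R).
  have := @cvg_geometric R ((sig - 1)^-1) (sig * z) _.
  rewrite ger0_norm // => /(_ sz) h.
  by have := @cvg_shiftS _ (geometric (sig - 1)^-1 (sig * z)) (nbhs (0 : R)) => ->.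
apply: (squeeze_cvgr _ (cvg_cst (0 : R)) lim).
apply: nearW => n; rewrite mulr_ge0 ?exprn_ge0 //= exprMn mulrA ler_wpM2r ?exprn_ge0 //.
by rewrite ler_pdivlMl // mulrC; exact: linear_le_geometric.
Qed.

Lemma geometric_growth (R : realType) (X be Q : R) : 0 < be -> be < Q -> 1 < Q ->
  exists p0, forall p, (p0 <= p)%N -> X * be ^+ p <= Q ^+ p - 1.
Proof.
move=> be0 beQ Q1; have Q0 : 0 < Q by lra.
have z1 : `|be / Q| < 1.
  by rewrite gtr0_norm ?divr_gt0 // ltr_pdivrMr // mul1r.
have z2 : `|Q^-1| < 1 by rewrite gtr0_norm ?invr_gt0 // invf_lt1.
have /cvgrPdist_lt/(_ _ (divr_gt0 ltr01 (ltr0Sn _ 1)))[N1 _ h1] :=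
  cvg_geometric X z1.
have /cvgrPdist_lt/(_ _ (divr_gt0 ltr01 (ltr0Sn _ 1)))[N2 _ h2] :=
  cvg_geometric (1 : R) z2.
exists (maxn N1 N2) => p; rewrite geq_max => /andP[p1 p2].
have := h1 p p1; have := h2 p p2; rewrite /geometric /= !sub0r !normrN mul1r.
move=> /(le_lt_trans (ler_norm _)) k2 /(le_lt_trans (ler_norm _)) k1.
have Qp : 0 < Q ^+ p by rewrite exprn_gt0.
rewrite -(ler_pM2r (_ : 0 < (Q ^+ p)^-1)) ?invr_gt0 // mulrBl divff ?gt_eqF //.
rewrite mul1r -mulrA -expr_div_n -exprVn; lra.
Qed.

Lemma powR_exprn (R : realType) (x t : R) n : 0 <= x -> (x ^+ n) `^ t = (x `^ t) ^+ n.
Proof. by move=> x0; rewrite -powR_mulrn // powRAC powR_mulrn // powR_ge0. Qed.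

Lemma exists_large_powR (R : realType) (X eps t : R) : 0 < eps -> 0 < t ->
  exists h, forall h', h <= h' -> X <= eps * h' `^ t.
Proof.
move=> e0 t0; exists ((`|X| / eps) `^ t^-1) => h' hh.
have Xe : 0 <= `|X| / eps by rewrite divr_ge0 // ltW.
apply: (le_trans (ler_norm _)); rewrite -ler_pdivrMl // mulrC.
rewrite -[leLHS]powRr1 // -(mulVf (lt0r_neq0 t0)) powRrM.
apply: ge0_ler_powR => //; rewrite ?nnegrE ?powR_ge0 ?(ltW t0) //.
exact: le_trans (powR_ge0 _ _) hh.
Qed.

(** * Spectra of the finite convolutions *)

(** The analytic properties on which the construction of spectra rests.  They
    are satisfied when [phi] is the squared modulus of the Fourier transform of
    the measure, [M] is that of the uniform measure on the digits, [L] is a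
    translate of the second member of a Hadamard triple, and [Gam] consists of
    the periods of [M]. *)
Record self_similar_spectral_data (R : realType) (b q : nat) (Gam : set R)
    (g0 K : R) (L : seq R) (M phi : R -> R) : Prop := {
  ssd_q : (1 < q)%N;
  ssd_qb : (q < b)%N;
  Gam0 : Gam 0;
  GamD : forall x y, Gam x -> Gam y -> Gam (x + y);
  GamN : forall x, Gam x -> Gam (- x);
  Gam_int : forall z : int, Gam z%:~R;
  Gam_g0 : Gam g0;
  g0_gt0 : 0 < g0;
  Gam_discrete : forall x, Gam x -> x != 0 -> g0 <= `|x|;
  K_gt0 : 0 < K;
  size_L : size L = q;
  L0 : 0 \in L;
  L_int : forall l, l \in L -> exists z : int, l = z%:~R;
  M_ge0 : forall x, 0 <= M x;
  M_periodic : forall x g, Gam g -> M (x + g) = M x;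
  M_eq1 : forall x, M x = 1 -> Gam x;
  M_zeros : exists s : seq R, forall x : R, 0 <= x < 1 -> M x = 0 -> x \in s;
  M_sum : forall x, \sum_(l <- L) M ((x + l) / b%:R) = 1;
  phi_ge0 : forall x, 0 <= phi x;
  phi_le1 : forall x, phi x <= 1;
  phi0 : phi 0 = 1;
  phiN : forall x, phi (- x) = phi x;
  phi_lip : forall x y, `|phi x - phi y| <= K * `|x - y|;
  phi_scale : forall x, phi x = M (x / b%:R) * phi (x / b%:R)
}.

Section SpectralData.
Context (R : realType) (b q : nat) (Gam : set R) (g0 K : R) (L : seq R)
  (M phi : R -> R).
Hypothesis H : self_similar_spectral_data b q Gam g0 K L M phi.
Local Notation B := (b%:R : R).

Let B_ge3 : 3 <= B.
Proof. by rewrite ler_nat (leq_trans _ (ssd_qb H)) // ltnS (ssd_q H). Qed.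

Let B_ge1 : 1 <= B. Proof. by apply: le_trans B_ge3; lra. Qed.
Let B_gt0 : 0 < B. Proof. by apply: lt_le_trans B_ge3. Qed.
Let B_neq0 : B != 0. Proof. by rewrite gt_eqF. Qed.
Let Bn_gt0 n : 0 < B ^+ n. Proof. by rewrite exprn_gt0. Qed.
Let Bn_neq0 n : B ^+ n != 0. Proof. by rewrite gt_eqF. Qed.

Lemma GamMn x n : Gam x -> Gam (n%:R * x).
Proof.
move=> gx; elim: n => [|n IH]; first by rewrite mul0r; exact: (Gam0 H).
by rewrite -natr1 mulrDl mul1r; exact: (GamD H).
Qed.

Lemma GamMBn x n : Gam x -> Gam (B ^+ n * x).
Proof. by move=> gx; rewrite -natrX; exact: GamMn. Qed.

Lemma GamB x y : Gam x -> Gam y -> Gam (x - y).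
Proof. by move=> gx gy; apply: (GamD H) => //; exact: (GamN H). Qed.

Lemma Gam_L l : l \in L -> Gam l.
Proof. by move=> /(L_int H)[z ->]; exact: (Gam_int H). Qed.

Lemma M0 : M 0 = 1.
Proof. by have := phi_scale H 0; rewrite !mul0r (phi0 H) mulr1. Qed.

(** The squared modulus of the Fourier transform of the convolution of the
    first [n] factors of the measure. *)
Definition prodM n x := \prod_(j < n) M (x / B ^+ j.+1).

Lemma prodM0 x : prodM 0 x = 1.
Proof. by rewrite /prodM big_ord0. Qed.

Lemma prodM_ge0 n x : 0 <= prodM n x.
Proof. by apply: prodr_ge0 => i _; exact: (M_ge0 H). Qed.

Lemma prodMD m n x : prodM (m + n) x = prodM m x * prodM n (x / B ^+ m).
Proof.
rewrite /prodM big_split_ord /=; congr (_ * _); apply: eq_bigr => i _.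
by rewrite -addnS exprD invfM mulrA.
Qed.

Lemma prodM1 x : prodM 1 x = M (x / B).
Proof. by rewrite /prodM big_ord1 expr1. Qed.

Lemma prodM_at0 n : prodM n 0 = 1.
Proof. by rewrite /prodM big1 // => i _; rewrite mul0r M0. Qed.

Lemma prodM_periodic n x g : Gam g -> prodM n (x + B ^+ n * g) = prodM n x.
Proof.
move=> gg; apply: eq_bigr => i _; rewrite mulrDl.
have -> : B ^+ n * g / B ^+ i.+1 = B ^+ (n - i.+1) * g.
  by rewrite -{1}(subnK (ltn_ord i)) exprD mulrAC mulfK.
by rewrite (M_periodic H) //; exact: GamMBn.
Qed.

Lemma phi_prodM n x : phi x = prodM n x * phi (x / B ^+ n).
Proof.
elim: n => [|n IH]; first by rewrite prodM0 mul1r expr0 divr1.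
have -> : x / B ^+ n.+1 = x / B ^+ n / B by rewrite exprSr invfM mulrA.
by rewrite IH -addn1 prodMD prodM1 -mulrA -(phi_scale H).
Qed.

Lemma prodM_ge_phi n x : phi x <= prodM n x.
Proof.
rewrite (phi_prodM n x) -[leRHS]mulr1 ler_wpM2l ?prodM_ge0 //.
exact: (phi_le1 H).
Qed.

(** [level_spectrum m Lam] says that the exponentials with frequencies in
    [Lam] form a spectrum of the [m]-th convolution factor of the measure. *)
Definition level_spectrum m (Lam : seq R) :=
  forall x, \sum_(l <- Lam) prodM m (x + l) = 1.

Lemma level_spectrum0 : level_spectrum 0 [:: 0].
Proof. by move=> x; rewrite big_seq1 prodM0. Qed.

Lemma level_spectrum1 : level_spectrum 1 L.
Proof.
by move=> x; under eq_bigr do rewrite prodM1; rewrite (M_sum H).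
Qed.

(** Evaluating the Parseval identity at [- l] leaves no room for a second
    nonzero term, the one with index [l] being already equal to one. *)
Lemma level_spectrum_orth m Lam l :
  level_spectrum m Lam -> l \in Lam ->
  \sum_(k <- rem l Lam) prodM m (k - l) = 0.
Proof.
move=> /(_ (- l)) + lL; rewrite (perm_big _ (perm_to_rem lL)) big_cons /=.
rewrite addNr prodM_at0 => /(canRL (addKr _)); rewrite addNr => {2}<-.
by apply: eq_bigr => k _; rewrite addrC.
Qed.

Lemma prodM_rem m Lam l k : level_spectrum m Lam -> l \in Lam ->
  k \in rem l Lam -> prodM m (k - l) = 0.
Proof.
move=> sp lL kr; have /eqP := level_spectrum_orth sp lL.
rewrite psumr_eq0 => [|i _]; last exact: prodM_ge0.
by move=> /allP/(_ _ kr) /eqP.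
Qed.

Lemma level_spectrum_uniq m Lam : level_spectrum m Lam -> uniq Lam.
Proof.
move=> sp; apply: count_mem_uniq => l.
case: (boolP (l \in Lam)) => [lL|/count_memPn ->//].
rewrite (permP (perm_to_rem lL)) /= eqxx; suff -> : count_mem l (rem l Lam) = 0%N by [].
apply/count_memPn/negP => /(prodM_rem sp lL).
by rewrite subrr prodM_at0 => /eqP; rewrite oner_eq0.
Qed.

Lemma prodM_orth m Lam l k : level_spectrum m Lam -> l \in Lam ->
  k \in Lam -> k != l -> prodM m (k - l) = 0.
Proof.
move=> sp lL kL kl; apply: (prodM_rem sp lL).
by rewrite (mem_rem_uniq _ (level_spectrum_uniq sp)) inE kl.
Qed.

Lemma phi_orth m Lam l k : level_spectrum m Lam -> l \in Lam ->
  k \in Lam -> k != l -> phi (k - l) = 0.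
Proof.
by move=> sp lL kL kl; rewrite (phi_prodM m) (prodM_orth sp) ?mul0r.
Qed.

(** A spectrum of the first [m] factors and one of the next [p] factors combine
    to one of the first [m + p].  Since [prodM (m + p)] has period
    [B ^+ (m + p) * Gam], every point may moreover be displaced by such a
    period, independently of the others. *)
Lemma level_spectrum_ext m p Lam Lam' (k : R -> R -> R) :
  level_spectrum m Lam -> level_spectrum p Lam' ->
  {in Lam', forall l', Gam l'} -> (forall l l', Gam (k l l')) ->
  level_spectrum (m + p)
    [seq l + B ^+ m * l' + B ^+ (m + p) * k l l' | l <- Lam, l' <- Lam'].
Proof.
move=> sp sp' LG kG x; rewrite big_allpairs_dep /=.
transitivity (\sum_(l <- Lam) prodM m (x + l)); last exact: sp.
apply: eq_bigr => l _.
rewrite -[RHS]mulr1 -[X in _ * X](sp' ((x + l) / B ^+ m)) mulr_sumr.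
apply: eq_big_seq => l' l'L.
rewrite !addrA prodM_periodic // prodMD prodM_periodic; last exact: LG.
by rewrite mulrDl [X in prodM p (_ + X)]mulrC mulKf.
Qed.

Lemma exists_level_spectrum p : exists Lam,
  [/\ level_spectrum p Lam, size Lam = (q ^ p)%N, 0 \in Lam &
      {in Lam, forall l, Gam l}].
Proof.
elim: p => [|p [Lam [sp sz z0 LG]]].
  exists [:: 0]; split => //; first exact: level_spectrum0.
    by rewrite inE.
  by move=> l; rewrite inE => /eqP ->; exact: (Gam0 H).
exists [seq l + B ^+ p * l' + B ^+ (p + 1) * 0 | l <- Lam, l' <- L]; split.
- rewrite -addn1; apply: (level_spectrum_ext (k := fun _ _ => 0)) => //.
  + exact: level_spectrum1.
  + exact: Gam_L.
  + by move=> _ _; exact: (Gam0 H).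
- by rewrite size_allpairs sz (size_L H) expnSr.
- apply/allpairsP; exists (0, 0) => /=; split; [by []|exact: (L0 H)|].
  by rewrite !mulr0 !addr0.
- move=> l /allpairsP[[l1 l2] /= [h1 h2 ->]]; rewrite mulr0 addr0.
  by apply: (GamD H); [exact: LG|exact/GamMBn/Gam_L].
Qed.

(** * Translates on which the transform does not vanish *)

(** Provides the nonzero factor that [vanishing_child] asks for. *)
Lemma exists_M_neq0 x : exists2 l, l \in L & M ((x + l) / B) != 0.
Proof.
apply: contrapT => h; have := M_sum H x; rewrite big1_seq.
  by move/esym/eqP; rewrite oner_eq0.
by move=> l /= lL; apply: contrapT => /eqP Ml; apply: h; exists l.
Qed.

Lemma L_inj_mod l l' g : l \in L -> l' \in L -> Gam g ->
  l - l' = B * g -> l = l'.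
Proof.
move=> lL l'L gg e; apply: contrapT => /eqP ne.
have := prodM_orth level_spectrum1 l'L lL ne.
rewrite prodM1 e mulrC mulKf // -[g]add0r (M_periodic H) // M0 => /eqP.
by rewrite oner_eq0.
Qed.

(** A set that will turn out to be empty. *)
Let Z x := forall g, Gam g -> phi (x + g) = 0.

Lemma vanishing_child x l : Z x -> l \in L -> M ((x + l) / B) != 0 ->
  Z ((x + l) / B).
Proof.
move=> Zx lL Ml g gg; have := Zx (l + B * g).
rewrite (phi_scale H) addrA mulrDl [B * g / B]mulrAC divff // mul1r.
rewrite (M_periodic H) // => e; apply/eqP.
have /e/eqP : Gam (l + B * g).
  by apply: (GamD H); [exact: Gam_L|rewrite -[B]expr1; exact: GamMBn].
by rewrite mulf_eq0 (negbTE Ml).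
Qed.

Lemma vanishing_translate x g : Z x -> Gam g -> Z (x + g).
Proof. by move=> Zx gg k gk; rewrite -addrA; apply: Zx; exact: (GamD H). Qed.

Lemma phi_neq0_near x : K * `|x| < 1 -> phi x != 0.
Proof.
move=> hx; apply/eqP => p0; have := phi_lip H x 0.
by rewrite p0 (phi0 H) sub0r normrN normr1 subr0 leNgt hx.
Qed.

Lemma small_div (x : R) e : 0 < e -> exists n0, forall n, (n0 <= n)%N -> x / B ^+ n < e.
Proof.
move=> e0; exists (Num.truncn `|x / e|).+1 => n hn.
rewrite ltr_pdivrMr // -ltr_pdivrMl // mulrC.
apply: (le_lt_trans (ler_norm _)).
apply: lt_le_trans (truncnS_gt _) _.
rewrite -natrX ler_nat (leq_trans hn) // ltnW // ltn_expl //.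
by rewrite (leq_trans (ssd_q H)) // ltnW // (ssd_qb H).
Qed.

(** Up to the first few scales [phi] is a finite product of dilates of [M],
    so it inherits from [M] the finiteness of its zeros. *)
Lemma phi_zeros : exists s : seq R, forall x : R, 0 <= x < 1 -> phi x = 0 -> x \in s.
Proof.
have [s0 hs0] := M_zeros H.
have [n /(_ n (leqnn n)) hn] := small_div K ltr01.
exists [seq B ^+ i.+1 * z | i <- iota 0 n, z <- s0] => x /andP[x0 x1] px.
have : prodM n x = 0.
  apply/eqP; have := phi_prodM n x; rewrite px => /esym/eqP.
  rewrite mulf_eq0 => /orP[//|/eqP p0]; exfalso.
  move: (@phi_neq0_near (x / B ^+ n)); rewrite p0 eqxx => h.
  have /h : K * `|x / B ^+ n| < 1; last by [].
  have Bi0 : 0 <= (B ^+ n)^-1 by rewrite invr_ge0 ltW.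
  rewrite ger0_norm ?mulr_ge0 // mulrCA; apply: le_lt_trans hn.
  rewrite ler_piMl ?(ltW x1) // mulr_ge0 // ltW //; exact: (K_gt0 H).
move/eqP; rewrite prodf_seq_eq0 => /hasP[i _ /=] /eqP Mi.
apply/allpairsP; exists (nat_of_ord i, x / B ^+ i.+1) => /=; split.
- by rewrite mem_iota /= add0n.
- apply: hs0 => //; rewrite mulr_ge0 ?invr_ge0 ?(ltW (Bn_gt0 _)) //= ltr_pdivrMr // mul1r.
  apply: lt_le_trans x1 _; apply: exprn_ege1; apply: le_trans B_ge3; lra.
- by rewrite mulrCA divff ?mulr1.
Qed.

Let fr (y : R) : R := y - (Num.floor y)%:~R.

Let fr_itv y : 0 <= fr y < 1.
Proof. by have := floor_itv y; rewrite /fr intrD; lra. Qed.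

Let fr_child_inj (x y l l' : R) : 0 <= x < 1 -> 0 <= y < 1 -> l \in L -> l' \in L ->
  fr ((x + l) / B) = fr ((y + l') / B) -> x = y /\ l = l'.
Proof.
move=> x01 y01 lL l'L; rewrite /fr; set u := Num.floor _; set v := Num.floor _.
move=> e; have [zl ezl] := L_int H lL; have [zl' ezl'] := L_int H l'L.
have e1 : (x + l) - (y + l') = B * (u - v)%:~R.
  rewrite intrB.
  have -> : u%:~R - v%:~R = (x + l) / B - (y + l') / B :> R by lra.
  by rewrite mulrBr ![B * _]mulrC !divfK.
have e2 : x - y = (zl' - zl + b%:Z * (u - v))%:~R.
  rewrite intrD intrB intrM -ezl -ezl' -pmulrn -e1; lra.
have xy : x = y.
  apply/eqP; rewrite -subr_eq0 e2 intr_eq0.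
  have : (-1 < zl' - zl + b%:Z * (u - v) < 1)%R.
    rewrite -(ltr_int R) -[X in _ && X](ltr_int R) -e2; lra.
  by case: (_ + _) => [[|]|[|]].
split => //; apply: (L_inj_mod lL l'L (Gam_int H (u - v))).
by rewrite -e1 xy; lra.
Qed.

(** Suppose some point [x] has only zeros of [phi] among its translates, and
    let [s0] be the finite set of such points in the unit interval.  Taking
    the fractional part of [(y + l) / B] maps the pairs with
    [M ((y + l) / B) != 0] injectively into [s0], and every [y] in [s0] has at
    least one such [l].  By counting there is exactly one, for which then
    [M ((y + l) / B) = 1]; this forces [(y + l) / B], hence [y], into the
    period group, which contradicts [phi 0 = 1]. *)
Lemma exists_phi_neq0 x : exists2 g, Gam g & phi (x + g) != 0.
Proof.
apply: contrapT => hx; have Zx : Z x.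
  move=> g gg; apply/eqP; apply: contrapT => /negP gn; apply: hx; by exists g.
have [s hs] := phi_zeros.
have Z_fr y : Z y -> Z (fr y).
  by move=> Zy; apply: vanishing_translate => //; exact/(GamN H)/(Gam_int H).
pose s0 := [seq y <- undup s | `[< Z y /\ 0 <= y < 1 >] ].
have s0P y : y \in s0 <-> Z y /\ 0 <= y < 1.
  rewrite mem_filter mem_undup; split => [/andP[/asboolP] //|[Zy y01]].
  apply/andP; split; [by apply/asboolP|apply: hs => //].
  by rewrite -[y]addr0; apply: Zy; exact: (Gam0 H).
have s0u : uniq s0 by rewrite filter_uniq // undup_uniq.
have /boolp.choice[l_ hl] : forall y, exists l, l \in L /\ M ((y + l) / B) != 0.
  by move=> y; have [l lL Ml] := exists_M_neq0 y; exists l.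
pose f y := fr ((y + l_ y) / B).
have fs0 y l : y \in s0 -> l \in L -> M ((y + l) / B) != 0 ->
    fr ((y + l) / B) \in s0.
  move=> /s0P[Zy y01] lL Ml; apply/s0P; split => //.
  by apply: Z_fr; apply: vanishing_child.
have fu : uniq (map f s0).
  rewrite map_inj_in_uniq // => y z /s0P[_ y01] /s0P[_ z01] e.
  by have [] := fr_child_inj y01 z01 (hl y).1 (hl z).1 e.
have f_sub : {subset map f s0 <= s0}.
  by move=> _ /mapP[y ys ->]; apply: fs0 => //; have [] := hl y.
have [_ f_onto] := uniq_min_size fu f_sub (eq_leq (esym (size_map f s0))).
set y := fr x.
have ys0 : y \in s0 by apply/s0P; split; [exact: Z_fr|exact: fr_itv].
have y01 := (s0P y).1 ys0; have {y01} y01 := y01.2.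
have M1 : M ((y + l_ y) / B) = 1.
  rewrite -[RHS](M_sum H y) (bigD1_seq (l_ y)) ?(hl y).1 //=; last first.
    exact: level_spectrum_uniq level_spectrum1.
  rewrite big1_seq ?addr0 // => l /andP[lne lL].
  apply: contrapT => /eqP Ml; have := fs0 _ _ ys0 lL Ml.
  rewrite -f_onto => /mapP[z /s0P[_ z01]] e.
  have [yz ll] := fr_child_inj y01 z01 lL (hl z).1 e.
  by move: lne; rewrite ll yz eqxx.
have gy : Gam y.
  have := M_eq1 H M1 => /(GamMBn 1); rewrite expr1 mulrCA divff // mulr1 => h.
  by rewrite -[y](addrK (l_ y)); apply: GamB => //; apply: Gam_L; have [] := hl y.
have := (s0P y).1 ys0 => -[/(_ (- y) (GamN H gy)) + _].
by rewrite subrr (phi0 H) => /eqP; rewrite oner_eq0.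
Qed.

(** Since [L] has fewer than [b] elements, some multiple [x] of [g0] is
    incongruent to every [- l] modulo [B * Gam].  A translate above a child of
    [x] at which [phi] does not vanish then gives a period other than the
    origin. *)
Lemma exists_period_phi_gt0 : exists a, [/\ Gam a, 0 < a & 0 < phi a].
Proof.
have gg := Gam_g0 H; have g00 := g0_gt0 H.
have [c hc] : exists c : nat, forall l g, l \in L -> Gam g -> c%:R * g0 + l <> B * g.
  apply: contrapT => h.
  have /boolp.choice[l_ hl] : forall c : nat, exists l, l \in L /\
      exists2 g, Gam g & c%:R * g0 + l = B * g.
    move=> c; apply: contrapT => h'; apply: h; exists c => l g lL gl e; apply: h'.
    by exists l; split => //; exists g.
  have u : uniq (map l_ (iota 0 b)).
    rewrite map_inj_in_uniq ?iota_uniq // => c c'.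
    rewrite !mem_iota /= !add0n => cb c'b e.
    have [_ [g Gg eg]] := hl c; have [_ [g' Gg' eg']] := hl c'.
    apply: contrapT => /eqP ne.
    have Gd : Gam (g - g') by exact: GamB.
    have ed : (c%:R - c'%:R) * g0 = B * (g - g') by rewrite mulrBr -eg -eg' e; ring.
    have cc : `|c%:R - c'%:R| < B :> R.
      have : c%:R < B by rewrite ltr_nat.
      have : c'%:R < B by rewrite ltr_nat.
      have := ler0n R c; have := ler0n R c'; rewrite ltr_norml; lra.
    have gne : g - g' != 0.
      apply/eqP => e0; move: ed; rewrite e0 mulr0 => /eqP; rewrite mulf_eq0 (gt_eqF g00).
      by rewrite orbF subr_eq0 eqr_nat (negbTE ne).
    have := Gam_discrete H Gd gne.
    have e1 : `|c%:R - c'%:R| * g0 = B * `|g - g'|.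
      by rewrite -{1}(gtr0_norm g00) -{1}(gtr0_norm B_gt0) -!normrM ed.
    by rewrite leNgt -(ltr_pM2l B_gt0) -e1 ltr_pM2r // cc.
  have := uniq_leq_size u (s2 := L); rewrite size_map size_iota (size_L H).
  move=> le; have : (b <= q)%N by apply: le => _ /mapP[c _ ->]; have [] := hl c.
  by rewrite leqNgt (ssd_qb H).
set x := c%:R * g0; have [l lL Ml] := exists_M_neq0 x.
have [g Gg pg] := exists_phi_neq0 ((x + l) / B).
set a := B * ((x + l) / B + g).
have ea : a = x + l + B * g by rewrite /a mulrDr mulrCA divff // mulr1.
have Ga : Gam a.
  rewrite ea; apply: (GamD H); first apply: (GamD H).
  - exact: GamMn.
  - exact: Gam_L.
  - exact: GamMn.
have pa : 0 < phi a.
  rewrite lt_neqAle (phi_ge0 H) andbT eq_sym (phi_scale H).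
  rewrite (_ : a / B = (x + l) / B + g); last by rewrite /a mulrC mulKf.
  by rewrite (M_periodic H) // mulf_neq0.
have a0 : a != 0.
  apply/eqP => a0; apply: (hc l (- g) lL (GamN H Gg)).
  by rewrite mulrN; apply/eqP; rewrite -subr_eq0 opprK -ea a0.
have [ap|an|a00] := ltgtP a 0.
- by exists (- a); rewrite oppr_gt0 (phiN H); split => //; exact: (GamN H).
- by exists a.
- by rewrite a00 eqxx in a0.
Qed.

(** Compactness of the unit interval, applied to the supremum of the quotients
    [phi (x + g) / (1 + `|g|)]: it is Lipschitz in [x], and a lower bound for
    it bounds at once [phi] from below and [g] from above. *)
Lemma equi_positivity : exists e C : R, [/\ 0 < e, 0 < C &
  forall x, exists g, [/\ Gam g, `|x + g| <= C & e <= phi (x + g)]].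
Proof.
pose F x g := phi (x + g) / (1 + `|g|).
pose S x := [set F x g | g in Gam].
have g1 (g : R) : 0 < 1 + `|g| by rewrite ltr_wpDr.
have F_le1 x g : F x g <= 1.
  rewrite /F ler_pdivrMr // mul1r (le_trans (phi_le1 H _)) // lerDl.
  exact: normr_ge0.
have S_sup x : has_sup (S x).
  split; first by exists (F x 0), 0 => //; exact: (Gam0 H).
  by exists 1 => _ [g _ <-].
have FLe x y g : F x g <= F y g + K * `|x - y|.
  have h : phi (x + g) - phi (y + g) <= K * `|x - y|.
    apply: le_trans (ler_norm _) _; apply: le_trans (phi_lip H _ _) _.
    by rewrite (_ : x + g - (y + g) = x - y) //; ring.
  rewrite -lerBlDl -mulrBl ler_pdivrMr //; apply: le_trans h _.
  by rewrite ler_peMr ?lerDl // mulr_ge0 // ltW // (K_gt0 H).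
have GLe x y : sup (S x) <= sup (S y) + K * `|x - y|.
  apply: ge_sup; first exact: (S_sup x).1.
  move=> _ [g gg <-]; apply: le_trans (FLe x y g) _; rewrite lerD2r.
  by apply: (ub_le_sup (S_sup y).2); exists g.
have Gc : continuous (fun x => sup (S x)).
  move=> x; apply/cvgrPdist_lt => e e0; near=> y.
  have d : `|x - y| < e / K by near: y; exists (e / K) => //; exact: divr_gt0 e0 (K_gt0 H).
  rewrite ltr_pdivlMr ?(K_gt0 H) // mulrC in d.
  have := GLe x y; have := GLe y x; rewrite (distrC y x) ltr_norml; lra.
have [c _ hc] := EVT_min (ler01 : 0 <= 1 :> R) (continuous_subspaceT Gc).
have [g gg pg] := exists_phi_neq0 c.
have Gc0 : 0 < sup (S c).
  apply: (@lt_le_trans _ _ (F c g)).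
    by rewrite divr_gt0 // lt_neqAle eq_sym pg (phi_ge0 H).
  by apply: (ub_le_sup (S_sup c).2); exists g.
have e0 : 0 < sup (S c) / 2 by rewrite divr_gt0.
exists (sup (S c) / 2), (1 + (sup (S c) / 2)^-1); split => //.
  by rewrite ltr_wpDr // invr_ge0 ltW.
move=> x; pose y := fr x.
have y01 : y \in `[0, 1]%R by rewrite in_itv /=; have := fr_itv x; rewrite -/y; lra.
have [_ [k gk <-] hk] : exists2 z, S y z & sup (S c) / 2 < z.
  by apply: sup_gt (S_sup y).1 _; have := hc _ y01; lra.
have k1 : sup (S c) / 2 * (1 + `|k|) <= phi (y + k).
  by rewrite -ler_pdivlMr // ltW.
exists (k - (Num.floor x)%:~R); have -> : x + (k - (Num.floor x)%:~R) = y + k.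
  by rewrite /y /fr; ring.
split; first by apply: GamB => //; exact: (Gam_int H).
- apply: le_trans (ler_normD _ _) _; apply: lerD.
    by rewrite ger0_norm; have := fr_itv x; rewrite -/y; lra.
  rewrite -[_^-1]mulr1 ler_pdivlMl //.
  have := phi_le1 H (y + k); nra.
- by apply: le_trans k1; rewrite ler_peMr ?lerDl // ltW.
Unshelve. all: by end_near.
Qed.

Lemma phi_ge_near x y : phi x - K * `|x - y| <= phi y.
Proof. by have := phi_lip H x y; rewrite ler_norml; lra. Qed.

(** Positivity survives arbitrarily far shifts: with [phi a > 0], translating
    [z] by [B ^+ k * a] leaves the first [k] factors of [phi z] unchanged and
    moves the remaining one close to [phi a]. *)
Lemma far_positivity : exists e d C a : R, exists k0 : nat,
  [/\ 0 < e, 0 < d, 0 < C, Gam a & 0 < a] /\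
  forall x, exists g, [/\ Gam g, `|x + g| <= C &
    forall k y, (k0 <= k)%N -> `|y| <= d -> e <= phi (x + g + B ^+ k * a + y)].
Proof.
have [e [C [e0 C0 heC]]] := equi_positivity.
have [a [Ga a0 pa]] := exists_period_phi_gt0.
have K0 := K_gt0 H.
pose d := e / (K * 2).
have d0 : 0 < d by rewrite divr_gt0 // mulr_gt0.
have [k0 hk0] := small_div (K * (C + d)) (divr_gt0 pa (ltr0Sn _ 1)).
exists (e / 2 * (phi a / 2)), d, C, a, k0.
split; first by split => //; rewrite !(divr_gt0, mulr_gt0).
move=> x; have [g [Gg gC eg]] := heC x; exists g; split => // k y kk yd.
rewrite -addrA [B ^+ k * a + y]addrC addrA.
set z := x + g + y.
have zC : `|z| <= C + d by apply: le_trans (ler_normD _ _) _; exact: lerD.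
have pz : e / 2 <= phi z.
  apply: le_trans (phi_ge_near (x + g) z).
  have -> : x + g - z = - y by rewrite /z; ring.
  rewrite normrN; have : K * `|y| <= K * d by rewrite ler_pM2l.
  have -> : K * d = e / 2 by rewrite /d; field; rewrite gt_eqF.
  lra.
rewrite [leRHS](phi_prodM k) prodM_periodic // mulrDl [B ^+ k * a]mulrC mulfK //.
apply: ler_pM; try by rewrite ltW // divr_gt0.
  exact: le_trans pz (prodM_ge_phi _ _).
apply: le_trans (phi_ge_near a _).
have -> : a - (z / B ^+ k + a) = - (z / B ^+ k) by ring.
have := hk0 _ kk; rewrite normrN normrM normfV (gtr0_norm (Bn_gt0 k)) mulrA.
have : K * `|z| / B ^+ k <= K * (C + d) / B ^+ k.
  by rewrite ler_pM2r ?invr_gt0 // ler_pM2l.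
lra.
Qed.

(** * One step of the construction *)

Lemma pow_separated i j : i != j -> 1 <= `|B ^+ i - B ^+ j|.
Proof.
wlog ij : i j / (i < j)%N => [hw|_].
  by case: (ltngtP i j) => // ij _; [|rewrite distrC]; apply: hw; rewrite ?ltn_eqF.
have Bi : 1 <= B ^+ i by exact: exprn_ege1.
have : B ^+ i.+1 <= B ^+ j.
  by exact: ler_weXn2l.
rewrite exprS distrC; move: (ler_norm (B ^+ j - B ^+ i)) B_ge3; nra.
Qed.

Definition stage_inv m (Lam : seq R) :=
  [/\ level_spectrum m Lam, 0 \in Lam & {in Lam, forall l, Gam l}].

(** Passage from the level [m] to the level [m'].  The parameters [e] and [d]
    measure the positivity of [phi] near the rescaled new points, [eps] the
    smallness of the old points and of the total number of points, [c] and [t]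
    the density to be reached; [h'] is the half length below which an interval
    sees only one component of [Lam']. *)
Record refines (e d t c eps : R) m (Lam : seq R) m' (Lam' : seq R) (h' : R) :
    Prop := {
  ref_lt : (m < m')%N;
  ref_sub : {subset Lam <= Lam'};
  ref_old : forall l, l \in Lam -> `|l| <= eps * B ^+ m';
  ref_new : forall l y, l \in Lam' -> l \notin Lam -> `|y| <= d ->
    e <= phi (l / B ^+ m' + y);
  ref_size : (size Lam')%:R <= eps * h' `^ t;
  ref_count : forall x h, h <= h' ->
    [\/ (count_in x h Lam' <= count_in x h Lam)%N,
        (count_in x h Lam' <= 1)%N |
        g0 * B ^+ m / 2 <= h /\ (count_in x h Lam')%:R <= c * h `^ t + 1];
  ref_dense : exists x h, g0 * B ^+ m / 2 <= h /\
    c * h `^ t <= (count_in x h Lam')%:R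
}.

(** As [B `^ t < q%:R], the [q ^ p] points of a level exceed the allowed density
    [c] on an interval of the size [B ^+ (m + p)] of that level once [p] is
    large. *)
Lemma exists_level_increment (t c eps C : R) m (Lam : seq R) :
  B `^ t < q%:R -> 0 < eps -> 0 < C ->
  exists p, [/\ (0 < p)%N,
    forall l, l \in Lam -> `|l| <= eps * B ^+ (m + p) &
    c * (C * B ^+ (m + p)) `^ t <= (q ^ p)%:R - 1].
Proof.
move=> tq eps0 C0.
have [n0 hn0] := small_div (\sum_(l <- Lam) `|l|) eps0.
have q1 : 1 < q%:R :> R by rewrite ltr1n (ssd_q H).
have [p1 hp1] := geometric_growth (c * (C * B ^+ m) `^ t) (powR_gt0 t B_gt0) tq q1.
exists (maxn 1 (maxn n0 p1)); split.
- by rewrite leq_max.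
- move=> l lL; rewrite -ler_pdivrMr //.
  have /hn0/ltW : (n0 <= m + maxn 1 (maxn n0 p1))%N.
    by rewrite (leq_trans _ (leq_addl _ _)) // !leq_max leqnn !orbT.
  apply: le_trans; rewrite ler_pM2r ?invr_gt0 //.
  by rewrite (big_rem _ lL) /= lerDl sumr_ge0.
- have Bp : 0 <= B ^+ maxn 1 (maxn n0 p1) by exact: ltW.
  rewrite exprD mulrA powRM // ?powR_exprn ?(ltW B_gt0) //; last first.
    by apply: mulr_ge0; exact: ltW.
  by rewrite mulrA natrX; apply: hp1; rewrite !leq_max leqnn !orbT.
Qed.

(** The points of [Lam'] are [l + B ^+ m * l' + B ^+ m' * kk l l'], with [l] in
    [Lam] and [l'] in a spectrum of the factors from [m] to [m'].  The periods
    [kk l l'] can be chosen freely.  They vanish for [l' = 0], which keeps the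
    old points.  For the others [far_positivity] allows the choice
    [ga (l, l') + B ^+ (k1 + ex l l') * a], with any exponent [ex l l'], while
    [phi] stays bounded below.  Equal exponents keep points in one cluster,
    different exponents separate them as much as desired.  The extensions of
    the old point [0] alone would, if kept together, be too dense: a prefix of
    them, given by [density_prefix], gets the exponent [0] and forms a cluster
    of density [c].  All other new points get exponents of their own. *)
Lemma exists_refinement : exists e d : R, [/\ 0 < e, 0 < d &
  forall (t c eps hmin : R) m Lam, 0 < t -> B `^ t < q%:R -> 0 < c -> 0 < eps ->
    stage_inv m Lam ->
    exists m' Lam' h', [/\ stage_inv m' Lam', hmin <= h' &
      refines e d t c eps m Lam m' Lam' h']].
Proof.
have [e [d [C [a [k0 [[e0 d0 C0 Ga a0] far]]]]]] := far_positivity.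
exists e, d; split => // t c eps hmin m Lam t0 tq c0 eps0 [sp z0 LamG].
have g00 := g0_gt0 H.
pose C' := C + 1 + g0.
have C'0 : 0 < C' by rewrite /C'; lra.
have eps1 : 0 < Num.min 1 eps by rewrite lt_min ltr01.
have [p [p0 pold pfull]] := exists_level_increment c m Lam tq eps1 C'0.
set m' := (m + p)%N in pold pfull *.
have old_eps l : l \in Lam -> `|l| <= eps * B ^+ m'.
  move=> /pold h; apply: le_trans h _; rewrite ler_pM2r // ge_min lexx orbT //.
have old1 l : l \in Lam -> `|l| <= B ^+ m'.
  by move=> /pold h; apply: le_trans h _; rewrite ler_piMl ?(ltW (Bn_gt0 _)) // ge_min lexx.
have [Lp [spp szp zp LpG]] := exists_level_spectrum p.
have /boolp.choice[ga hga] : forall ll : R * R, exists g, [/\ Gam g,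
    `|(ll.1 + B ^+ m * ll.2) / B ^+ m' + g| <= C &
    forall k y, (k0 <= k)%N -> `|y| <= d ->
      e <= phi ((ll.1 + B ^+ m * ll.2) / B ^+ m' + g + B ^+ k * a + y)].
  by move=> ll; exact: far.
pose core l l' := l + B ^+ m * l' + B ^+ m' * ga (l, l').
have core_le l l' : `|core l l'| <= C * B ^+ m'.
  have [_ h _] := hga (l, l').
  have -> : core l l' = B ^+ m' * ((l + B ^+ m * l') / B ^+ m' + ga (l, l')).
    by rewrite /core; field.
  by rewrite normrM (gtr0_norm (Bn_gt0 _)) mulrC ler_pM2r.
pose Lp0 : seq R := rem 0 Lp.
have Lpu := level_spectrum_uniq spp.
pose cl := [seq core 0 l' | l' <- Lp0].
(* all the points extending the old point 0 lie in one window of length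
   comparable to B ^+ m', and there are too many of them *)
have full : exists x h, g0 * B ^+ m / 2 <= h /\ c * h `^ t <= (count_in x h cl)%:R.
  exists 0, (C' * B ^+ m'); split.
    have Bmm : B ^+ m <= B ^+ m'.
      rewrite exprD ler_peMr ?(ltW (Bn_gt0 _)) //.
      exact: exprn_ege1.
    have := Bn_gt0 m; rewrite /C'; nra.
  apply: (le_trans pfull).
  have /eqP -> : count_in 0 (C' * B ^+ m') cl == size cl.
    rewrite -all_count; apply/allP => _ /mapP[l' _ ->].
    have := core_le 0 l'; have := Bn_gt0 m'; rewrite ler_norml /C'; nra.
  rewrite size_map size_rem // szp -subn1 natrB // expn_gt0.
  by rewrite (leq_trans _ (ssd_q H)).
have gm0 : 0 < g0 * B ^+ m / 2 by rewrite divr_gt0 // mulr_gt0.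
have [kc [[xs [hs [hs1 hs2]]] sel_le]] := density_prefix c0 gm0 full.
pose sel : seq R := take kc Lp0.
pose pairs := [seq (l, l') | l <- Lam, l' <- Lp].
pose ex (l l' : R) : nat := if (l == 0) && (l' \in sel) then 0%N else (index (l, l') pairs).+1.
have [h1 hh1] := exists_large_powR (size Lam * q ^ p)%:R eps0 t0.
pose h' := Num.max hmin h1.
have [k1 [k01 hk1]] : exists k1, (k0 <= k1)%N /\
  2 * h' + (2 * C + 1) * B ^+ m' <= B ^+ m' * B ^+ k1 * a.
  have [n0 hn0] := small_div (2 * h' + (2 * C + 1) * B ^+ m') (mulr_gt0 (Bn_gt0 m') a0).
  exists (maxn k0 n0); split; first exact: leq_maxl.
  have := hn0 _ (leq_maxr k0 n0); rewrite ltr_pdivrMr // => /ltW.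
  by rewrite mulrAC.
pose U := B ^+ m' * B ^+ k1 * a.
pose kk (l l' : R) : R := if l' == 0 then 0 else ga (l, l') + B ^+ (k1 + ex l l') * a.
pose pos l l' := l + B ^+ m * l' + B ^+ m' * kk l l'.
pose Lam' := [seq pos l l' | l <- Lam, l' <- Lp].
have kkG l l' : Gam (kk l l').
  rewrite /kk; case: eqP => _; first exact: (Gam0 H).
  by apply: (GamD H); [have [] := hga (l, l')|exact: GamMBn].
have posE l l' : l' != 0 -> pos l l' = core l l' + U * B ^+ ex l l'.
  by move=> l'0; rewrite /pos /kk (negbTE l'0) /core /U exprD; ring.
have pos0 l : pos l 0 = l by rewrite /pos /kk eqxx !mulr0 !addr0.
have spL : level_spectrum m' Lam' by exact: level_spectrum_ext.
have Lu := level_spectrum_uniq spL.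
have LamG' : {in Lam', forall l, Gam l}.
  move=> _ /allpairsP[[l l'] /= [lL l'L ->]]; apply: (GamD H); first apply: (GamD H).
  - exact: LamG.
  - exact/GamMBn/LpG.
  - exact: GamMBn.
have subL : {subset Lam <= Lam'}.
  by move=> l lL; apply/allpairsP; exists (l, 0); rewrite /= pos0.
have U0 : 0 < U by rewrite !mulr_gt0.
(* points with different exponents, and new and old points, are far apart *)
have Bm'0 := Bn_gt0 m'.
have far_new l l' j j' : l' != 0 -> j' != 0 -> ex l l' != ex j j' ->
    2 * h' <= `|pos l l' - pos j j'|.
  move=> l'0 j'0 /pow_separated s1; rewrite !posE //.
  have -> : core l l' + U * B ^+ ex l l' - (core j j' + U * B ^+ ex j j') =
    U * (B ^+ ex l l' - B ^+ ex j j') - (core j j' - core l l') by ring.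
  have s2 := lerB_dist (U * (B ^+ ex l l' - B ^+ ex j j')) (core j j' - core l l').
  apply: le_trans s2; rewrite normrM (gtr0_norm U0).
  have := ler_normB (core j j') (core l l').
  have : U <= U * `|B ^+ ex l l' - B ^+ ex j j'| by rewrite ler_peMr // ltW.
  move: (core_le j j') (core_le l l') hk1 Bm'0; rewrite -/U; clear; lra.
have far_old l j j' : l \in Lam -> j' != 0 -> 2 * h' <= `|pos j j' - l|.
  move=> /old1 l1 j'0; rewrite posE //.
  have -> : core j j' + U * B ^+ ex j j' - l =
    U * B ^+ ex j j' - (l - core j j') by ring.
  apply: le_trans (lerB_dist _ _).
  have := ler_normB l (core j j'); have := core_le j j'.
  have : U <= U * B ^+ ex j j'.
    by rewrite ler_peMr ?(ltW U0) //; exact: exprn_ege1.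
  rewrite (gtr0_norm (mulr_gt0 U0 (Bn_gt0 _))).
  move: (ltW (mulr_gt0 C0 Bm'0)) hk1 l1; rewrite -/U; clear; lra.
have sel_inv l' : l' \in sel -> l' \in Lp /\ l' != 0.
  by move/mem_take; rewrite mem_rem_uniq // inE => /andP[].
have ex0 l l' : ex l l' = 0%N -> l = 0 /\ l' \in sel.
  by rewrite /ex; case: ifP => // /andP[/eqP].
have ex_inj l l' j j' : l \in Lam -> l' \in Lp -> j \in Lam -> j' \in Lp ->
    ex l l' = ex j j' -> ex l l' != 0%N -> l = j /\ l' = j'.
  move=> lL l'L jL j'L; rewrite /ex; case: ifP => // _; case: ifP => // _ [e1] _.
  have inP : forall u v, u \in Lam -> v \in Lp -> (u, v) \in pairs.
    by move=> u v uL vL; apply/allpairsP; exists (u, v).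
  have := nth_index (0, 0) (inP _ _ lL l'L).
  by rewrite e1 nth_index ?inP // => -[-> ->].
have posU l' : l' \in sel -> pos 0 l' = core 0 l' + U.
  move=> ls; have [_ l'0] := sel_inv _ ls.
  by rewrite posE // /ex eqxx ls expr0 mulr1.
pose CL := [seq y + U | y <- take kc cl].
have CLE : CL = [seq pos 0 l' | l' <- sel].
  by rewrite /CL /cl -map_take -map_comp; apply/eq_in_map => l' /posU.
have inv' : stage_inv m' Lam' by split => //; exact: subL.
exists m', Lam', h'; split; [exact: inv'|by rewrite le_max lexx|split].
- by rewrite /m' -[X in (X < _)%N]addn0 ltn_add2l.
- exact: subL.
- exact: old_eps.
- move=> l y /allpairsP[[l1 l2] /= [lL l'L ->]] nL yd.
  have l20 : l2 != 0 by apply: contra nL => /eqP ->; rewrite pos0.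
  have [_ _ /(_ (k1 + ex l1 l2)%N y)] := hga (l1, l2).
  rewrite (leq_trans k01 (leq_addr _ _)) => /(_ isT yd) /=.
  congr (_ <= phi _); rewrite /pos /kk (negbTE l20); field.
  by rewrite !Bn_neq0.
- rewrite size_allpairs szp; apply: hh1; by rewrite le_max lexx orbT.
- move=> x h hh.
  case: (pselect (exists l l', [/\ l \in Lam, l' \in Lp, l' != 0 &
      x - h < pos l l' < x + h])) => [|none]; last first.
    apply: Or31; apply: count_in_sub => // _ /allpairsP[[l l'] /= [lL l'L ->]] yI.
    have [l'0|l'0] := eqVneq l' 0; first by rewrite l'0 pos0.
    by exfalso; apply: none; exists l, l'.
  move=> [j [j' [jL j'L j'0 jI]]].
  have close y z : x - h < y < x + h -> x - h < z < x + h -> ~~ (2 * h' <= `|y - z|).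
    by move=> yI zI; rewrite -ltNge; exact: window_dist_lt hh yI zI.
  have same l l' : l \in Lam -> x - h < pos l l' < x + h ->
      l' != 0 /\ ex l l' = ex j j'.
    move=> lL yI; have l'0 : l' != 0.
      apply/eqP => l'0; move: yI; rewrite l'0 pos0 => yI.
      by have := close _ _ jI yI; rewrite far_old.
    split => //; apply/eqP; apply: contraT => ne.
    by have := close _ _ yI jI; rewrite far_new.
  have [exj|exj] := eqVneq (ex j j') 0%N; last first.
    apply: Or32; apply: leq_trans (count_in_size x h [:: pos j j']).
    apply: count_in_sub => // _ /allpairsP[[l l'] /= [lL l'L ->]] yI.
    have [l'0 e1] := same _ _ lL yI; rewrite inE.
    by have [|-> ->] := ex_inj _ _ _ _ lL l'L jL j'L e1; rewrite ?e1.
  have inCL y : y \in Lam' -> x - h < y < x + h -> exists2 l', l' \in sel & y = pos 0 l'.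
    move=> /allpairsP[[l l'] /= [lL l'L ->]] yI.
    have [l'0] := same _ _ lL yI; rewrite exj => /ex0[-> l's].
    by exists l'.
  have [hm|hm] := leP (g0 * B ^+ m / 2) h.
    apply: Or33; split => //; apply: le_trans (sel_le (x - U) h hm).
    rewrite -count_in_shift -/CL CLE ler_nat; apply: count_in_sub => // y yL yI.
    by have [l' ls ->] := inCL _ yL yI; apply: map_f.
  apply: Or32; apply: count_in_le1 => // y z yL zL yz yI zI.
  have [l' ls ey] := inCL _ yL yI; have [i' is_ ez] := inCL _ zL zI.
  have exg : exists2 g, Gam g & y - z = B ^+ m * g.
    exists (l' - i' + B ^+ p * (ga (0, l') - ga (0, i'))).
      have [? _] := sel_inv _ ls; have [? _] := sel_inv _ is_.
      apply: (GamD H); first by apply: GamB; exact: LpG.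
      by apply/GamMBn/GamB; [have [] := hga (0, l')|have [] := hga (0, i')].
    by rewrite ey ez !posU // /core /m' exprD; ring.
  have [g Gg eg] := exg.
  have g_neq0 : g != 0 by apply: contra_neq yz => g_0; apply/eqP; rewrite -subr_eq0 eg g_0 mulr0.
  rewrite eg normrM (gtr0_norm (Bn_gt0 m)).
  apply: (@le_trans _ _ (B ^+ m * g0)); first by lra.
  by rewrite ler_pM2l //; exact: (Gam_discrete H).
- exists (xs + U), hs; split => //; apply: le_trans hs2 _.
  have uCL : uniq CL.
    have : uniq [seq pos l l' | l <- 0 :: rem 0 Lam, l' <- Lp].
      rewrite -(perm_uniq (perm_allpairs pos (perm_to_rem z0) (perm_refl Lp))).
      exact: Lu.
    rewrite allpairs_cons cat_uniq CLE => /and3P[+ _ _]; apply: subseq_uniq.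
    by apply: map_subseq; apply: subseq_trans (take_subseq _ _) (rem_subseq _ _).
  have -> : xs = xs + U - U by ring.
  rewrite -count_in_shift -/CL ler_nat addrK; apply: count_in_sub => // y.
  rewrite CLE => /mapP[l' ls ->] _; apply/allpairsP; exists (0, l') => /=.
  by have [? _] := sel_inv _ ls.
Qed.

(** * The limit of the construction *)

(** [Lam n] is the set of frequencies present after [n] steps and [m n] its
    level; every interval of half length at most [h n.+1] sees at most one
    component of [Lam n.+1]. *)
Record refinement_sequence (e d t : R) (c : nat -> R)
    (m : nat -> nat) (Lam : nat -> seq R) (h : nat -> R) : Prop := {
  rs_inv : forall n, stage_inv (m n) (Lam n);
  rs_h_ge : forall n, n%:R <= h n;
  rs_h_le : forall n, h n <= h n.+1;
  rs_ref : forall n,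
    refines e d t (c n) n.+1%:R^-1 (m n) (Lam n) (m n.+1) (Lam n.+1) (h n.+1)
}.

Lemma exists_refinement_sequence : exists e d : R, [/\ 0 < e, 0 < d &
  forall t c, 0 < t -> B `^ t < q%:R -> (forall n, 0 < c n) ->
    exists m Lam h, refinement_sequence e d t c m Lam h].
Proof.
have [e [d [e0 d0 step]]] := exists_refinement.
exists e, d; split => // t c t0 tq c0.
pose inv (st : nat * seq R * R) := stage_inv st.1.1 st.1.2.
have /boolp.choice[f hf] : forall nst : nat * (nat * seq R * R), exists st,
    inv nst.2 -> [/\ inv st, Num.max nst.1.+1%:R nst.2.2 <= st.2 &
      refines e d t (c nst.1) nst.1.+1%:R^-1 nst.2.1.1 nst.2.1.2
        st.1.1 st.1.2 st.2].
  move=> [n [[m Lam] h]] /=.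
  have [i|ni] := pselect (inv (m, Lam, h)); last by exists (m, Lam, h).
  have n0 : 0 < n.+1%:R^-1 :> R by rewrite invr_gt0.
  have [m' [Lam' [h' [i' hh' r]]]] :=
    step t (c n) n.+1%:R^-1 (Num.max n.+1%:R h) m Lam t0 tq (c0 n) n0 i.
  by exists (m', Lam', h').
pose st := fix st n := if n is k.+1 then f (k, st k) else (0%N, [:: 0] : seq R, 0 : R).
have st_inv n : inv (st n).
  elim: n => [|n IH]; last by have [] := hf (n, st n) IH.
  split; [exact: level_spectrum0|by rewrite inE|].
  by move=> l; rewrite inE => /eqP ->; exact: (Gam0 H).
exists (fun n => (st n).1.1), (fun n => (st n).1.2), (fun n => (st n).2).
split => //.
- case=> [//|n]; have [_ + _] := hf (n, st n) (st_inv n).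
  by rewrite ge_max => /andP[].
- move=> n; have [_ + _] := hf (n, st n) (st_inv n).
  by rewrite ge_max => /andP[].
- by move=> n; have [_ _] := hf (n, st n) (st_inv n).
Qed.

Section RefinementSequence.
Context (e d t : R) (c : nat -> R) (m : nat -> nat) (Lam : nat -> seq R)
  (h : nat -> R).
Hypothesis (e0 : 0 < e) (d0 : 0 < d) (t0 : 0 < t).
Hypothesis rs : refinement_sequence e d t c m Lam h.

Lemma rs_level n : (n <= m n)%N.
Proof.
by elim: n => [//|n IH]; exact: leq_ltn_trans IH (ref_lt (rs_ref rs n)).
Qed.

Lemma rs_sp n : level_spectrum (m n) (Lam n).
Proof. by have [] := rs_inv rs n. Qed.

Lemma rs_uniq n : uniq (Lam n).
Proof. exact: level_spectrum_uniq (rs_sp n). Qed.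

Lemma rs_sub i j : (i <= j)%N -> {subset Lam i <= Lam j}.
Proof.
move=> /subnK <-; elim: (j - i)%N => [//|k IH] l lL.
by apply: (ref_sub (rs_ref rs _)); exact: IH.
Qed.

Lemma rs_h_mono i j : (i <= j)%N -> h i <= h j.
Proof.
move=> /subnK <-; elim: (j - i)%N => [//|k IH].
by apply: le_trans IH _; exact: (rs_h_le rs).
Qed.

Let Q x n := \sum_(l <- Lam n) phi (x + l).

Lemma sum_old_new F n : \sum_(l <- Lam n.+1) F l =
  \sum_(l <- Lam n) F l + \sum_(l <- Lam n.+1 | l \notin Lam n) F l :> R.
Proof.
rewrite (bigID (mem (Lam n))) /=; congr (_ + _).
rewrite -big_filter; apply: perm_big; apply: uniq_perm.
- exact: filter_uniq (rs_uniq _).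
- exact: rs_uniq.
- move=> l; rewrite mem_filter /=; case: (boolP (l \in Lam n)) => //= lL.
  exact: (rs_sub (leqnSn n)).
Qed.

(** The Parseval identity at level [m n.+1] splits into old and new points.
    At an old point the remaining factor of [phi] is close to one, at a new
    point it is at least [e]. *)
Lemma rs_gain (x : R) n (eta := K * (`|x| / B ^+ m n.+1 + n.+1%:R^-1)) :
  `|x| / B ^+ m n.+1 <= d -> eta <= 1 ->
  1 - eta <= Q x n + (Q x n.+1 - Q x n) / e.
Proof.
move=> xd eta1; have ref := rs_ref rs n; set m' := m n.+1 in xd eta eta1 ref *.
have eta0 : 0 <= eta.
  by rewrite mulr_ge0 ?addr_ge0 ?invr_ge0 ?(ltW (K_gt0 H)) // divr_ge0 // ltW.
pose P l := prodM m' (x + l).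
have P0 l : 0 <= P l by exact: prodM_ge0.
have sumP : \sum_(l <- Lam n) P l + \sum_(l <- Lam n.+1 | l \notin Lam n) P l = 1.
  by rewrite -sum_old_new; exact: rs_sp.
have sumQ : Q x n.+1 - Q x n = \sum_(l <- Lam n.+1 | l \notin Lam n) phi (x + l).
  by rewrite /Q sum_old_new addrAC subrr add0r.
have old : (1 - eta) * \sum_(l <- Lam n) P l <= Q x n.
  rewrite mulr_sumr big_seq [leRHS]big_seq; apply: ler_sum => l lL.
  rewrite (phi_prodM m') mulrC ler_wpM2l //.
  have := phi_ge_near 0 ((x + l) / B ^+ m').
  rewrite (phi0 H) sub0r normrN; apply: le_trans.
  rewrite lerD2l lerN2 ler_pM2l ?(K_gt0 H) // normrM normfV (gtr0_norm (Bn_gt0 _)).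
  rewrite ler_pdivrMr // mulrDl divfK //.
  by apply: le_trans (ler_normD _ _) _; rewrite lerD2l; exact: (ref_old ref).
have new : e * \sum_(l <- Lam n.+1 | l \notin Lam n) P l <= Q x n.+1 - Q x n.
  rewrite sumQ mulr_sumr big_seq_cond [leRHS]big_seq_cond.
  apply: ler_sum => l /andP[lL lnL].
  rewrite (phi_prodM m') mulrC ler_wpM2l // mulrDl addrC.
  by apply: (ref_new ref) => //; rewrite normrM normfV (gtr0_norm (Bn_gt0 _)).
have new0 : 0 <= \sum_(l <- Lam n.+1 | l \notin Lam n) P l by exact: sumr_ge0.
rewrite -ler_pdivlMl // in new.
have -> : 1 - eta = (1 - eta) * (\sum_(l <- Lam n) P l) +
  (1 - eta) * \sum_(l <- Lam n.+1 | l \notin Lam n) P l by rewrite -mulrDr sumP mulr1.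
apply: lerD => //; apply: le_trans (_ : _ <= \sum_(l <- Lam n.+1 | l \notin Lam n) P l) _.
  by rewrite ler_piMl // gerBl.
by rewrite mulrC.
Qed.

(** As long as the Parseval sum [Q x n] does not exceed [1 - eps], every step from
    some rank on raises it by a fixed amount, which cannot last forever. *)
Lemma rs_parseval (x eps : R) : 0 < eps -> exists n, 1 - eps < Q x n.
Proof.
move=> eps0; apply: contrapT => none.
have Qle n : Q x n <= 1 - eps.
  by rewrite leNgt; apply/negP => lt; apply: none; exists n.
have Q0 n : 0 <= Q x n by apply: sumr_ge0 => l _; exact: (phi_ge0 H).
have K0 := K_gt0 H.
pose w := Num.min 1 (eps / 2).
have w0 : 0 < w by rewrite lt_min ltr01 divr_gt0.
have [w1 w2] : w <= 1 /\ w <= eps / 2.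
  by rewrite /w !ge_min !lexx orbT.
have wK : 0 < w / (2 * K) by rewrite divr_gt0 // mulr_gt0.
have [n1 hn1] := small_div `|x| d0.
have [n2 hn2] := small_div `|x| wK.
pose n3 := (Num.truncn (w / (2 * K))^-1).+1.
pose n0 := maxn n1 (maxn n2 n3).
have gain n : (n0 <= n)%N -> e * (eps / 2) <= Q x n.+1 - Q x n.
  rewrite !geq_max => /and3P[k1 k2 k3].
  have mn : (n <= m n.+1)%N by exact: leq_trans (leqnSn _) (rs_level _).
  have xd := ltW (hn1 _ (leq_trans k1 mn)).
  have xw := hn2 _ (leq_trans k2 mn).
  have nw : n.+1%:R^-1 <= w / (2 * K).
    rewrite invf_ple ?posrE //; apply: le_trans (ltW (truncnS_gt _)) _.
    by rewrite ler_nat ltnW.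
  have eta_w : K * (`|x| / B ^+ m n.+1 + n.+1%:R^-1) <= w.
    have -> : w = K * (w / (2 * K) + w / (2 * K)) by field; rewrite gt_eqF.
    by rewrite ler_pM2l // lerD // ltW.
  have := rs_gain xd (le_trans eta_w w1); have := Qle n.
  rewrite [e * _]mulrC -ler_pdivlMr //; move: eta_w.
  by move: (K * _) (_ / e) => eta gn; lra.
have grow k : k%:R * (e * (eps / 2)) <= Q x (n0 + k)%N.
  elim: k => [|k IH]; first by rewrite mul0r.
  have := gain (n0 + k)%N (leq_addr _ _); rewrite addnS -[k.+1%:R]natr1 mulrDl mul1r; lra.
have ee : 0 < e * (eps / 2) by rewrite mulr_gt0 // divr_gt0.
pose k := (Num.truncn (e * (eps / 2))^-1).+1.
have : 1 < k%:R * (e * (eps / 2)).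
  by rewrite -ltr_pdivrMr // mul1r; exact: truncnS_gt.
have := grow k; have := Qle (n0 + k)%N; lra.
Qed.

Lemma rs_h_interval J (r : R) : h J <= r -> exists N, (J <= N)%N /\ h N <= r < h N.+1.
Proof.
move=> hr.
have exN : exists n, r < h n.
  exists (Num.truncn r).+1; apply: lt_le_trans (truncnS_gt r) _.
  exact: (rs_h_ge rs).
case: (ex_minnP exN) => -[|N] rN Nmin.
  have := rs_h_mono (leq0n J); lra.
exists N; rewrite rN andbT; split; last first.
  by rewrite leNgt; apply/negP => /Nmin; rewrite ltnn.
rewrite leqNgt; apply/negP => NJ; have := rs_h_mono NJ; lra.
Qed.

(** An interval of half length between [h N] and [h N.+1] contains points of
    [Lam N] only, which are few at that scale, or of a single later component. *)
Lemma rs_count_le J (r x : R) n : h J.+1 <= r ->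
  (count_in x r (Lam n))%:R <= r `^ t / J.+1%:R + 1 \/
  exists j, [/\ (J <= j)%N, g0 / 2 * B ^+ m j <= r &
    (count_in x r (Lam n))%:R <= c j * r `^ t + 1].
Proof.
move=> /rs_h_interval[N [JN /andP[Nr rN]]].
have rt0 : 0 <= r `^ t by exact: powR_ge0.
have rJ0 : 0 <= r `^ t / J.+1%:R by rewrite divr_ge0.
have sizeN : (size (Lam N))%:R <= r `^ t / J.+1%:R.
  case: N JN Nr {rN} => [//|N] JN Nr.
  apply: le_trans (ref_size (rs_ref rs N)) _; rewrite mulrC.
  apply: ler_pM; rewrite ?powR_ge0 ?invr_ge0 //.
  - apply: ge0_ler_powR; rewrite ?(ltW t0) ?nnegrE //.
      by apply: le_trans (rs_h_ge rs _).
    by apply: le_trans Nr; apply: le_trans (rs_h_ge rs _).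
  - by rewrite lef_pV2 ?posrE // ler_nat.
have small k : (k <= N)%N -> (count_in x r (Lam k))%:R <= r `^ t / J.+1%:R + 1.
  move=> kN; apply: le_trans (_ : _ <= (size (Lam N))%:R) _; last first.
    by apply: le_trans sizeN _; rewrite lerDl.
  rewrite ler_nat; apply: leq_trans (count_in_size x r _).
  by apply: count_in_sub (rs_uniq _) _ => y yk _; exact: rs_sub yk.
elim: n => [|n IH]; first by left; exact: small.
have [nN|Nn] := leqP n.+1 N; first by left; exact: small.
have rn : r <= h n.+1 by apply: le_trans (ltW rN) (rs_h_mono _).
case: (ref_count (rs_ref rs n) x rn) => [le|le|[le1 le2]].
- case: IH => [le'|[j [j1 j2 j3]]]; [left|right; exists j; split => //].
    by apply: le_trans le'; rewrite ler_nat.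
  by apply: le_trans j3; rewrite ler_nat.
- left; have : (count_in x r (Lam n.+1))%:R <= 1 :> R by rewrite (ler_nat _ _ 1).
  by move/le_trans; apply; rewrite lerDr.
- right; exists n; split => //; last by rewrite mulrAC.
  exact: leq_trans (ltnW JN) Nn.
Qed.
End RefinementSequence.

Lemma exists_profiled_spectrum (t : R) (c : nat -> R) :
  0 < t -> B `^ t < q%:R -> (forall n, 0 < c n) ->
  exists kap (Lam : nat -> seq R), [/\ 0 < kap,
    density_profile t c kap Lam,
    forall n l k, l \in Lam n -> k \in Lam n -> k != l -> phi (k - l) = 0 &
    forall x eps, 0 < eps ->
      exists n, 1 - eps < \sum_(l <- Lam n) phi (x + l)].
Proof.
move=> t0 tq c0.
have [e [d [e0 d0 /(_ t c t0 tq c0)]]] := exists_refinement_sequence.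
move=> [m [Lam [h rs]]].
have g20 : 0 < g0 / 2 by rewrite divr_gt0 // (g0_gt0 H).
have scale r j : g0 / 2 * B ^+ m j <= r -> g0 / 2 * 2 ^+ j <= r.
  apply: le_trans; rewrite ler_pM2l //.
  apply: le_trans (_ : B ^+ j <= _); last exact: ler_weXn2l (rs_level rs j).
  by apply: lerXn2r; rewrite ?nnegrE ?(ltW B_gt0) //; apply: le_trans B_ge3; lra.
exists (g0 / 2), Lam; split => //.
- split.
  + exact: rs_sub rs.
  + exact: rs_uniq rs.
  + move=> J; exists (h J.+1) => r x n hr.
    case: (rs_count_le t0 rs x n hr) => [?|[j [j1 /scale j2 j3]]]; first by left.
    by right; exists j.
  + move=> j; have [x [r [h1 h2]]] := ref_dense (rs_ref rs j).
    by exists j.+1, x, r; split => //; apply: scale; rewrite mulrAC.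
- move=> n l k; exact: phi_orth (rs_sp rs n).
- move=> x eps eps0; exact: rs_parseval rs _ _ eps0.
Qed.

End SpectralData.

(** * Beurling density and dimension of the union *)

Section BeurlingDensity.
Context (R : realType) (t : R) (c : nat -> R) (kap : R) (Lam : nat -> seq R).
Hypothesis (t0 : 0 < t) (kap0 : 0 < kap).
Hypothesis dp : density_profile t c kap Lam.

Let U := \bigcup_n [set` Lam n].

Lemma finite_sub_stage (s : seq R) : (forall l, l \in s -> U l) ->
  exists n, {subset s <= Lam n}.
Proof.
elim: s => [|l s IH] sU; first by exists 0%N.
have [n hn] : exists n, {subset s <= Lam n}.
  by apply: IH => k ks; apply: sU; rewrite inE ks orbT.
have [k _ lk] : U l by apply: sU; rewrite mem_head.
exists (maxn n k) => x; rewrite inE => /predU1P[->|/hn].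
  exact: (dp_sub dp (leq_maxr n k)).
exact: (dp_sub dp (leq_maxl n k)).
Qed.

Lemma counting_union_le x h (X : R) :
  (forall n, (count_in x h (Lam n))%:R <= X) ->
  (counting (U `&` [set` `]x - h, x + h[%R]) <= X%:E)%E.
Proof.
move=> leX.
have fin_le (S : {fset R}) : [set` S] `<=` U `&` [set` `]x - h, x + h[%R] ->
    #|` S|%:R <= X.
  move=> SU; have [n hn] : exists n, {subset enum_fset S <= Lam n}.
    by apply: finite_sub_stage => l lS; have [] := SU l lS.
  apply: le_trans (leX n); rewrite ler_nat /count_in -size_filter.
  apply: uniq_leq_size => [|l lS]; first exact: fset_uniq.
  by have [_] := SU l lS; rewrite mem_filter hn // andbT /= in_itv.
rewrite /counting; case: asboolP => [fin|inf].
  by rewrite lee_fin; apply: fin_le; rewrite fset_setK.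
have [S SU] := infinite_set_fset (Num.truncn X).+1 inf.
have := fin_le S SU; have := truncnS_gt X => h1 h2 h3.
by have := lt_le_trans h1 (le_trans _ h2); rewrite ltxx ler_nat => /(_ h3).
Qed.

Lemma counting_union_ge x h n :
  ((count_in x h (Lam n))%:R%:E <= counting (U `&` [set` `]x - h, x + h[%R]) :> \bar R)%E.
Proof.
rewrite /counting; case: asboolP => [fin|inf]; last by rewrite leey.
rewrite lee_fin ler_nat /count_in -size_filter.
apply: uniq_leq_size; first exact: filter_uniq (dp_uniq dp n).
move=> l; rewrite mem_filter => /andP[lI lL].
rewrite in_fset_set // inE; split; first by exists n.
by rewrite /= in_itv.
Qed.

Lemma upper_density_le (r a : R) : 0 < r -> 0 <= a -> t <= r ->
  (exists J0, forall j h, (J0 <= j)%N -> kap * 2 ^+ j <= h ->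
    c j * h `^ t <= a * h `^ r) ->
  (upper_beurling_density r U <= a%:E)%E.
Proof.
move=> r0 a0 tr [J0 hJ0]; apply/lee_addgt0Pr => eps eps0.
have eps2 : 0 < eps / 2 by rewrite divr_gt0.
have [J [J0J Jeps]] : exists J, (J0 <= J)%N /\ J.+1%:R^-1 <= eps / 2.
  exists (maxn J0 (Num.truncn (eps / 2)^-1)); split; first exact: leq_maxl.
  rewrite invf_ple ?posrE //; apply: le_trans (ltW (truncnS_gt _)) _.
  by rewrite ler_nat ltnS leq_maxr.
have [r0' hr0] := dp_upper dp J.
have [h1 hh1] := @exists_large_powR R 1 (eps / 2) r eps2 r0.
pose h0 := Num.max 1 (Num.max r0' h1).
rewrite /upper_beurling_density limf_esupE.
apply: (@le_trans _ _ (ereal_sup [set ereal_sup [set (counting (U `&`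
    [set` `]x - h, x + h[%R]) * ((h `^ r)^-1)%:E)%E | x in [set: R]] |
    h in [set h | h0 <= h]])).
  apply: ereal_inf_lbound; exists [set h | h0 <= h] => //.
  by apply: nbhs_pinfty_ge; exact: num_real.
apply: ge_ereal_sup => _ [h hh <-]; apply: ge_ereal_sup => _ [x _ <-].
have [h_ge1 [h_ger h_geh]] : 1 <= h /\ r0' <= h /\ h1 <= h.
  by move: hh; rewrite /= !ge_max => /and3P[].
have hr : 0 < h `^ r by rewrite powR_gt0 //; lra.
have htr : h `^ t <= h `^ r by apply: ler_powR.
have ht0 : 0 <= h `^ t by exact: powR_ge0.
rewrite -EFinD -(mulfK (lt0r_neq0 hr) (a + eps)) EFinM lee_pmul2r ?lte_fin ?invr_gt0 //.
apply: counting_union_le => n.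
have big1 := hh1 h h_geh.
case: (hr0 h x n h_ger) => [le|[j [Jj kj le]]]; apply: le_trans le _.
- have : h `^ t / J.+1%:R <= eps / 2 * h `^ r.
    by rewrite mulrC; apply: ler_pM => //; rewrite invr_ge0.
  have : 0 <= a * h `^ r by rewrite mulr_ge0 // ltW.
  by move: (h `^ t / _) => z; lra.
- have := hJ0 j h (leq_trans J0J Jj) kj; lra.
Qed.

Lemma upper_density_ge (r a : R) :
  (exists J0, forall j h, (J0 <= j)%N -> kap * 2 ^+ j <= h ->
    a * h `^ r <= c j * h `^ t) ->
  (a%:E <= upper_beurling_density r U)%E.
Proof.
move=> [J0 hJ0]; rewrite /upper_beurling_density limf_esupE.
apply: le_ereal_inf_tmp => _ [V Vy <-].
have [h0 [_ hV]] : \forall h \near +oo%R, V h by [].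
have [j [J0j hj]] : exists j, (J0 <= j)%N /\ h0 < kap * 2 ^+ j.
  pose j := maxn J0 (Num.truncn `|h0 / kap|).+1.
  exists j; split; first exact: leq_maxl.
  rewrite -ltr_pdivrMl // mulrC; apply: le_lt_trans (ler_norm _) _.
  apply: lt_le_trans (truncnS_gt _) _.
  by rewrite -natrX ler_nat; apply: leq_trans (ltnW (ltn_expl _ _)) => //; exact: leq_maxr.
have [n [x [h [kh le]]]] := dp_lower dp j.
have h_gt0 : 0 < h by apply: lt_le_trans kh; rewrite mulr_gt0 // exprn_gt0.
have hr : 0 < h `^ r by exact: powR_gt0.
apply: le_trans (_ : (counting (U `&` [set` `]x - h, x + h[%R]) * ((h `^ r)^-1)%:E <= _)%E).
  rewrite -[a](mulfK (lt0r_neq0 hr)) EFinM lee_pmul2r ?lte_fin ?invr_gt0 //.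
  apply: le_trans (counting_union_ge x h n); rewrite lee_fin.
  exact: le_trans (hJ0 j h J0j kh) le.
apply: (@le_trans _ _ (ereal_sup [set (counting (U `&`
    [set` `]x - h, x + h[%R]) * ((h `^ r)^-1)%:E)%E | x in [set: R]])).
  by apply: ereal_sup_ubound; exists x.
apply: ereal_sup_ubound; exists h => //; apply: hV; exact: lt_le_trans hj kh.
Qed.

Lemma upper_density_ge0 (r : R) : (forall j, 0 < c j) ->
  (0 <= upper_beurling_density r U)%E.
Proof.
move=> c0; apply: upper_density_ge; exists 0%N => j h _ _.
by rewrite mul0r mulr_ge0 ?powR_ge0 // ltW.
Qed.

Lemma pow2_dominates_linear (del X : R) : 0 < del -> 0 <= X ->
  exists J0, forall j h, (J0 <= j)%N -> kap * 2 ^+ j <= h ->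
    X * j.+1%:R <= h `^ del.
Proof.
move=> del0 X0; pose rho : R := 2 `^ del.
have rho1 : 1 < rho.
  have e1 : 1 `^ del = 1 :> R by rewrite powR1.
  by rewrite -{1}e1 /rho gt0_ltr_powR ?nnegrE ?ltr1n.
pose sig := (1 + rho) / 2.
have sig1 : 1 < sig by rewrite /sig; lra.
have lin j : j.+1%:R * (sig - 1) <= sig * sig ^+ j.
  by rewrite -exprS; exact: linear_le_geometric.
have kd : 0 < kap `^ del by exact: powR_gt0.
have s0 : 0 < sig - 1 by lra.
have [||J0 hJ0] := @geometric_growth R (X * sig / (sig - 1) / kap `^ del) sig rho _ _ rho1.
- by lra.
- by rewrite /sig; lra.
exists J0 => j h J0j hh; apply: (@le_trans _ _ ((kap * 2 ^+ j) `^ del)); last first.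
  have k2 : 0 <= kap * 2 ^+ j by rewrite mulr_ge0 ?exprn_ge0 // ltW.
  by apply: ge0_ler_powR; rewrite ?nnegrE ?(ltW del0) // (le_trans k2).
rewrite powRM ?(ltW kap0) ?exprn_ge0 // powR_exprn // -/rho.
rewrite -ler_pdivrMl //; apply: le_trans (_ : _ <= rho ^+ j - 1) _; last by lra.
apply: le_trans (hJ0 j J0j).
have -> : X * sig / (sig - 1) / kap `^ del * sig ^+ j =
  (kap `^ del)^-1 * (X * (sig * sig ^+ j / (sig - 1))) by ring.
by rewrite ler_pM2l ?invr_gt0 // ler_wpM2l // ler_pdivlMr.
Qed.

(** Targets of at most linear growth and decay do not affect the dimension,
    the scale of the [j]-th cluster being at least exponential in [j]. *)
Lemma beurling_dim_profile (A : R) : 0 < A ->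
  (forall j, 0 < c j /\ c j <= A * j.+1%:R /\ 1 <= A * j.+1%:R * c j) ->
  beurling_dim U = t%:E.
Proof.
move=> A0 cA; apply/eqP; rewrite eq_le; apply/andP; split.
  apply/lee_addgt0Pr => eps eps0; apply: ereal_inf_lbound.
  exists (t + eps) => //; split; first by rewrite addr_ge0 // ltW.
  apply/eqP; rewrite eq_le upper_density_ge0; last by move=> j; have [] := cA j.
  rewrite andbT; apply/lee_addgt0Pr => a a0; rewrite add0e.
  apply: upper_density_le; [exact: addr_gt0|exact: ltW|by rewrite lerDl ltW|].
  have Aa : 0 <= A / a by rewrite divr_ge0 // ltW.
  have [J0 hJ0] := pow2_dominates_linear eps0 Aa.
  exists J0 => j h J0j hh; have := hJ0 j h J0j hh => big.
  have h0 : 0 < h by apply: lt_le_trans hh; rewrite mulr_gt0 ?exprn_gt0.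
  rewrite powRD; last by rewrite (gt_eqF h0) implybT.
  rewrite mulrCA mulrC ler_wpM2l ?powR_ge0 //.
  have [_ [cj _]] := cA j; apply: le_trans cj _.
  by rewrite -ler_pdivrMl //; apply: le_trans big; rewrite mulrA [A / a]mulrC.
apply: le_ereal_inf_tmp => _ [r [r0 Dr] <-]; rewrite lee_fin leNgt; apply/negP => rt.
have : (1%:E <= upper_beurling_density r U)%E; last by rewrite Dr lee_fin ler10.
apply: upper_density_ge.
have tr0 : 0 < t - r by lra.
have [J0 hJ0] := pow2_dominates_linear tr0 (ltW A0).
exists J0 => j h J0j hh; have := hJ0 j h J0j hh => big.
have h0 : 0 < h by apply: lt_le_trans hh; rewrite mulr_gt0 ?exprn_gt0.
have -> : h `^ t = h `^ r * h `^ (t - r).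
  rewrite -powRD; last by rewrite (gt_eqF h0) implybT.
  by congr (_ `^ _); ring.
rewrite mul1r mulrCA ler_peMr ?powR_ge0 //.
have [cj [_ le1]] := cA j; apply: le_trans le1 _.
by rewrite mulrC ler_pM2l.
Qed.

End BeurlingDensity.

(** Targets realizing any prescribed density: constant for a positive real,
    tending to zero for [0] and to infinity for [+oo]. *)
Lemma exists_targets (R : realType) (t : R) (s : \bar R) : 0 < t -> (0 <= s)%E ->
  exists c : nat -> R, (forall n, 0 < c n) /\
    forall (kap : R) Lam, 0 < kap -> density_profile t c kap Lam ->
      beurling_dim (\bigcup_n [set` Lam n]) = t%:E /\
      upper_beurling_density t (\bigcup_n [set` Lam n]) = s.
Proof.
move=> t0; have j1 j : 1 <= j.+1%:R :> R by rewrite ler1n.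
case: s => [s| |//]; rewrite ?lee_fin => s0.
- move: s0; rewrite le_eqVlt => /predU1P[<-|s0].
  + exists (fun j => j.+1%:R^-1); split => [n|kap Lam kap0 dp]; first by rewrite invr_gt0.
    split.
      apply: (beurling_dim_profile t0 kap0 dp ltr01) => j.
      rewrite invr_gt0 ltr0n mul1r divff ?lexx //; split => //; split => //.
      by apply: le_trans (j1 j); rewrite invf_le1.
    apply/eqP; rewrite eq_le (upper_density_ge0 kap0 dp) ?andbT; last by move=> j; rewrite invr_gt0.
    apply/lee_addgt0Pr => a a0; rewrite add0e.
    apply: (upper_density_le dp) => //; first exact: ltW.
    exists (Num.truncn a^-1) => j h aj _; rewrite ler_wpM2r ?powR_ge0 //.
    rewrite invf_ple ?posrE //; apply: le_trans (ltW (truncnS_gt _)) _.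
    by rewrite ler_nat ltnS.
  + exists (fun=> s); split => // kap Lam kap0 dp; split.
      apply: (beurling_dim_profile (A := s + s^-1) t0 kap0 dp).
        by rewrite addr_gt0 // invr_gt0.
      move=> j; have is0 : 0 < s^-1 by rewrite invr_gt0.
      have ss : s^-1 * s = 1 by rewrite mulVf // gt_eqF.
      by split => //; split; have := j1 j; nra.
    apply/eqP; rewrite eq_le; apply/andP; split.
      by apply: (upper_density_le dp) => //; [exact: ltW|exists 0%N].
    by apply: (upper_density_ge kap0 dp); exists 0%N.
- exists (fun j => j.+1%:R); split => // kap Lam kap0 dp; split.
    apply: (beurling_dim_profile t0 kap0 dp ltr01) => j; rewrite mul1r lexx.
    by split => //; split => //; have := j1 j; nra.
  apply/eqP; rewrite -leye_eq leye_eq; apply/eqP/eqyP => a a0.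
  apply: (upper_density_ge kap0 dp); exists (Num.truncn a) => j h aj _.
  rewrite ler_wpM2r ?powR_ge0 //; apply: le_trans (ltW (truncnS_gt _)) _.
  by rewrite ler_nat ltnS.
Qed.

(** * The mask of the digit set *)

Section Trigonometry.
Context (R : realType).
Implicit Types x y : R.

Lemma cos_lipschitz x y : `|cos x - cos y| <= `|x - y|.
Proof.
wlog xy : x y / x <= y => [hw|].
  by case: (leP x y) => [/hw//|/ltW/hw]; rewrite distrC [X in _ <= X]distrC.
have [c _ e] := @MVT_segment R cos (fun x => - sin x) x y xy
  (fun z _ => is_derive_cos z) (continuous_subspaceT (@continuous_cos R)).
rewrite distrC e normrM [X in _ <= X]distrC ler_piMl // normrN ler_norml.
by rewrite sin_geN1 sin_le1.
Qed.

Lemma sin_lipschitz x y : `|sin x - sin y| <= `|x - y|.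
Proof.
have e z : sin z = cos (z - pi / 2) by rewrite cosBpihalf.
rewrite !e; apply: le_trans (cos_lipschitz _ _) _.
by rewrite (_ : x - pi / 2 - (y - pi / 2) = x - y) //; ring.
Qed.

Lemma cos_sin_2pi_int x (z : int) :
  cos (x + 2 * pi * z%:~R) = cos x /\ sin (x + 2 * pi * z%:~R) = sin x.
Proof.
have pos (n : nat) y : cos (y + 2 * pi * n%:R) = cos y /\ sin (y + 2 * pi * n%:R) = sin y.
  elim: n y => [|n IH] y; first by rewrite mulr0 addr0.
  have -> : y + 2 * pi * n.+1%:R = (y + 2 * pi * n%:R) + pi *+ 2.
    by rewrite -natr1 mulr2n; ring.
  by rewrite cosD2pi sinD2pi; exact: IH.
case: z => n; first exact: pos.
have [h1 h2] := pos n.+1 (x + 2 * pi * (Negz n)%:~R).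
rewrite -h1 -h2; have -> : x + 2 * pi * (Negz n)%:~R + 2 * pi * n.+1%:R = x.
  by rewrite NegzE mulrNz -pmulrn; ring.
by [].
Qed.

Lemma cos_2pi_eq1 x : cos (2 * pi * x) = 1 -> exists z : int, x = z%:~R.
Proof.
pose y := x - (Num.floor x)%:~R => c1.
have y01 : 0 <= y < 1 by have := floor_itv x; rewrite /y intrD; lra.
have cy : cos (2 * pi * y) = 1.
  rewrite -(cos_sin_2pi_int (2 * pi * y) (Num.floor x)).1 -[RHS]c1.
  by congr (cos _); rewrite /y; ring.
exists (Num.floor x); apply/eqP; rewrite -subr_eq0 -/y; apply: contraT => yn0.
have y0 : 0 < y by rewrite lt_neqAle eq_sym yn0; case/andP: y01.
have sp : 0 < sin (pi * y).
  apply: sin_gt0_pi; rewrite mulr_gt0 ?pi_gt0 //= -[ltRHS]mulr1 ltr_pM2l ?pi_gt0 //.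
  by case/andP: y01.
have := cos_mulr2n (pi * y); rewrite (_ : (pi * y) *+ 2 = 2 * pi * y); last first.
  by rewrite mulr2n; ring.
have := sin2cos2 (pi * y); rewrite cy mulr2n; nra.
Qed.

Lemma expi2pi_inj01 x y : 0 <= x < 1 -> 0 <= y < 1 ->
  cos (2 * pi * x) = cos (2 * pi * y) -> sin (2 * pi * x) = sin (2 * pi * y) ->
  x = y.
Proof.
move=> x01 y01 hc hs.
have : cos (2 * pi * (x - y)) = 1.
  by rewrite mulrBr cosB hc hs -!expr2 cos2Dsin2.
move=> /cos_2pi_eq1[z e].
have zm : (-1 < z)%R by rewrite -(ltr_int R) -e; lra.
have zp : (z < 1)%R by rewrite -(ltr_int R) -e; lra.
have z0 : z = 0 by move: zm zp; case: z {e} => [[|]|[|]].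
by apply/eqP; rewrite -subr_eq0 e z0.
Qed.
End Trigonometry.

Section Mask.
Context (R : realType) (b : int) (q : nat) (D : {fset int}).
Implicit Types x g : R.

Definition mask_cos x := q%:R^-1 * \sum_(d <- enum_fset D) cos (2 * pi * x * d%:~R).
Definition mask_sin x := q%:R^-1 * \sum_(d <- enum_fset D) sin (2 * pi * x * d%:~R).
Definition mask_sq x := mask_cos x ^+ 2 + mask_sin x ^+ 2.

Lemma mask_sqE x : mask_sq x = q%:R^-2 *
  \sum_(d <- enum_fset D) \sum_(d' <- enum_fset D) cos (2 * pi * x * (d - d')%:~R).
Proof.
rewrite /mask_sq /mask_cos /mask_sin !exprMn -mulrDr -exprVn; congr (_ * _).
rewrite !expr2 !mulr_suml -big_split /=; apply: eq_bigr => d _.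
rewrite !mulr_sumr -big_split /=; apply: eq_bigr => d' _.
by rewrite intrB mulrBr cosB.
Qed.

Definition period_group : set R :=
  [set x | forall d, d \in D -> exists z : int, x * d%:~R = z%:~R].

Lemma mask_sq_periodic x g : period_group g -> mask_sq (x + g) = mask_sq x.
Proof.
move=> gg; have h d : d \in D ->
    cos (2 * pi * (x + g) * d%:~R) = cos (2 * pi * x * d%:~R) /\
    sin (2 * pi * (x + g) * d%:~R) = sin (2 * pi * x * d%:~R).
  move=> /gg[z ez]; have -> : 2 * pi * (x + g) * d%:~R = 2 * pi * x * d%:~R + 2 * pi * z%:~R.
    by rewrite -ez; ring.
  exact: cos_sin_2pi_int.
by rewrite /mask_sq /mask_cos /mask_sin; congr ((_ * _) ^+ 2 + (_ * _) ^+ 2);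
  rewrite big_seq [RHS]big_seq; apply: eq_bigr => d /h[].
Qed.

Hypothesis (D0 : 0 \in D) (q1 : (1 < q)%N) (hD : #|` D|%fset = q).

Let q_neq0 : q%:R != 0 :> R. Proof. by rewrite pnatr_eq0 -lt0n ltnW. Qed.

(** An average of unit vectors that has length one forces all of them to
    coincide; one of them is [1], as [0] is a digit. *)
Lemma mask_sq_eq1 x : mask_sq x = 1 -> period_group x.
Proof.
move=> M1; set u := mask_cos x; set v := mask_sin x.
have uv : u ^+ 2 + v ^+ 2 = 1 by [].
pose F d := (cos (2 * pi * x * d%:~R) - u) ^+ 2 + (sin (2 * pi * x * d%:~R) - v) ^+ 2.
have F0 d : 0 <= F d by rewrite addr_ge0 ?sqr_ge0.
have sumF : \sum_(d <- enum_fset D) F d = 0.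
  have FE d : F d = 2 - (2 * u * cos (2 * pi * x * d%:~R) + 2 * v * sin (2 * pi * x * d%:~R)).
    have cs := cos2Dsin2 (2 * pi * x * d%:~R).
    rewrite /F; move: cs; set c := cos _; set s := sin _ => cs.
    have -> : (c - u) ^+ 2 + (s - v) ^+ 2 = (c ^+ 2 + s ^+ 2) + (u ^+ 2 + v ^+ 2) - (2 * u * c + 2 * v * s) by ring.
    by rewrite cs uv; ring.
  have scale c (G : int -> R) : \sum_(d <- enum_fset D) c * G d = c * \sum_(d <- enum_fset D) G d.
    by rewrite mulr_sumr.
  under eq_bigr do rewrite FE; rewrite sumrB [X in _ - X]big_split /= !scale.
  have -> : \sum_(d <- enum_fset D) cos (2 * pi * x * d%:~R) = q%:R * u by rewrite mulrA divff ?mul1r.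
  have -> : \sum_(d <- enum_fset D) sin (2 * pi * x * d%:~R) = q%:R * v by rewrite mulrA divff ?mul1r.
  rewrite big_const_seq count_predT hD iter_addr_0 -[2 *+ q]mulr_natl.
  have -> : q%:R * 2 - (2 * u * (q%:R * u) + 2 * v * (q%:R * v)) = 2 * q%:R * (1 - (u ^+ 2 + v ^+ 2)) :> R by ring.
  by rewrite uv subrr mulr0.
have Fz d : d \in D -> F d = 0.
  move/eqP: sumF; rewrite psumr_eq0; last by move=> i _; exact: F0.
  by move=> /allP h /h /eqP.
have cd d : d \in D -> cos (2 * pi * x * d%:~R) = u.
  move=> /Fz /eqP; rewrite paddr_eq0 ?sqr_ge0 // !sqrf_eq0 => /andP[+ _].
  by rewrite subr_eq0 => /eqP.
have u1 : u = 1 by rewrite -(cd _ D0) mulr0 cos0.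
move=> d dD; apply: cos_2pi_eq1; by rewrite mulrA (cd _ dD).
Qed.

Local Open Scope complex_scope.

Lemma expi2piD (x y : R) : expi2pi (x + y) = expi2pi x * expi2pi y.
Proof. by apply/eqP; rewrite eq_complex /= mulrDr cosD sinD eqxx /= addrC eqxx. Qed.

Lemma expi2pi_conj (x : R) : Num.conj (expi2pi x) = expi2pi (- x).
Proof. by apply/eqP; rewrite eq_complex /= mulrN cosN sinN !eqxx. Qed.

Lemma expi2pi0 : expi2pi (0 : R) = 1.
Proof. by apply/eqP; rewrite eq_complex /= mulr0 cos0 sin0 !eqxx. Qed.

Lemma expi2piMn (x : R) n : expi2pi (x * n%:R) = expi2pi x ^+ n.
Proof.
elim: n => [|n IH]; first by rewrite mulr0 expi2pi0.
by rewrite -natr1 mulrDr mulr1 expi2piD IH exprSr.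
Qed.

(** A zero of the mask is a root of a nonzero polynomial in [expi2pi x]. *)
Lemma mask_sq_zeros : exists s : seq R, forall x : R, 0 <= x < 1 -> mask_sq x = 0 -> x \in s.
Proof.
pose m : nat := (\sum_(d <- enum_fset D) absz d)%N.
pose k (d : int) : nat := absz (d + m%:Z).
have kE d : d \in D -> (k d)%:Z = d + m%:Z.
  move=> dD; rewrite /k gez0_abs //.
  have : (absz d <= m)%N by rewrite /m (big_rem _ dD) /= leq_addr.
  rewrite -lez_nat abszE => dm; rewrite -lerBlDl sub0r; apply: le_trans dm.
  by rewrite -normrN ler_norm.
pose P : {poly R[i]} := \sum_(d <- enum_fset D) 'X^(k d).
have P0 : P != 0.
  apply/eqP => /(congr1 (fun p : {poly R[i]} => p`_(k 0))).
  rewrite coef0 /P coef_sum (bigD1_seq 0) ?fset_uniq //= coefXn eqxx big1_seq; last first.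
    move=> d /andP[d0 dD]; rewrite coefXn; case: eqP => // e.
    move: d0; have : (k d)%:Z = (k 0)%:Z by rewrite e.
    by rewrite !kE // => /addIr ->; rewrite eqxx.
  by rewrite addr0 => /eqP; rewrite oner_eq0.
have PE x : P.[expi2pi x] = expi2pi (x * m%:R) * \sum_(d <- enum_fset D) expi2pi (x * d%:~R).
  rewrite /P horner_sum mulr_sumr big_seq [RHS]big_seq; apply: eq_bigr => d dD.
  rewrite hornerXn -expi2piMn -expi2piD; congr expi2pi.
  by rewrite -mulrDr -[(k d)%:R]/((k d)%:Z%:~R) kE // intrD addrC.
have [rs hrs] := closed_field_poly_normal P.
exists [seq xget 0 [set x : R | 0 <= x < 1 /\ expi2pi x = z] | z <- rs] => x x01 Mx.
have : P.[expi2pi x] = 0.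
  rewrite PE (_ : \sum_(d <- _) _ = 0) ?mulr0 //.
  move: Mx => /eqP; rewrite paddr_eq0 ?sqr_ge0 // !sqrf_eq0 !mulf_eq0 !invr_eq0 (negbTE q_neq0) /=.
  move=> /andP[/eqP c0 /eqP s0].
  apply/eqP; rewrite eq_complex !raddf_sum /=.
  rewrite (eq_bigr (fun d : int => cos (2 * pi * x * d%:~R))) => [|d _]; last by rewrite mulrA.
  by rewrite [X in _ && (X == _)](eq_bigr (fun d : int => sin (2 * pi * x * d%:~R))) => [|d _]; rewrite ?mulrA // c0 s0 !eqxx.
rewrite hrs hornerZ => /eqP; rewrite mulf_eq0 lead_coef_eq0 (negbTE P0) /=.
rewrite horner_prod prodf_seq_eq0 => /hasP[z zrs /=].
rewrite hornerXsubC subr_eq0 => /eqP xz.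
apply/mapP; exists z => //; have := @xgetPex _ 0 [set x : R | 0 <= x < 1 /\ expi2pi x = z].
move=> /(_ (ex_intro _ x (conj x01 xz)))[y01].
move=> yz; have [ec es] := etrans yz (esym xz).
exact: expi2pi_inj01 x01 y01 (esym ec) (esym es).
Qed.

(** On expanding the square, the cross terms cancel because distinct rows of
    the Hadamard matrix are orthogonal. *)
Lemma mask_sq_sum (L : {fset int}) x : hadamard_triple R b D L ->
  #|` L|%fset = q /\ \sum_(l <- enum_fset L) mask_sq ((x + l%:~R) / b%:~R) = 1.
Proof.
move=> [q' [hq' hL hU]]; have qq : q' = q by rewrite -hq' hD.
rewrite qq in hL hU; split => //.
pose dd (i : 'I_q) : int := nth 0 (enum_fset D) i.
pose ll (j : 'I_q) : int := nth 0 (enum_fset L) j.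
have sumL (F : int -> R) : \sum_(l <- enum_fset L) F l = \sum_(j < q) F (ll j).
  by rewrite (big_nth 0) hL big_mkord.
have sumD (F : int -> R) : \sum_(d <- enum_fset D) F d = \sum_(i < q) F (dd i).
  by rewrite (big_nth 0) hD big_mkord.
have orth (i j : 'I_q) :
    \sum_(l < q) cos (2 * pi * ((dd i - dd j)%:~R * (ll l)%:~R / b%:~R)) = q%:R * (i == j)%:R :> R /\
    \sum_(l < q) sin (2 * pi * ((dd i - dd j)%:~R * (ll l)%:~R / b%:~R)) = 0 :> R.
  move/unitarymxP: hU => /matrixP/(_ i j); rewrite !mxE.
  have -> : \sum_(l < q) hadamard_matrix R b q D L i l * (hadamard_matrix R b q D L ^t*)%sesqui l j =
    (q%:R^-1)%:C * \sum_(l < q) expi2pi ((dd i - dd j)%:~R * (ll l)%:~R / b%:~R).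
    rewrite mulr_sumr; apply: eq_bigr => l _; rewrite !mxE -/(dd i) -/(dd j) -/(ll l).
    set a := (dd i)%:~R * _ / _; set a' := (dd j)%:~R * _ / _.
    have -> : (dd i - dd j)%:~R * (ll l)%:~R / b%:~R = a - a' by rewrite intrB /a /a'; ring.
    have sq2 : (Num.sqrt q%:R)^-1 * (Num.sqrt q%:R)^-1 = q%:R^-1 :> R.
      by rewrite -invfM -expr2 sqr_sqrtr.
    rewrite expi2piD -expi2pi_conj rmorphM /= -sq2 rmorphM /= mulrACA; congr (_ * _).
    by congr (_ * _); apply/eqP; rewrite eq_complex /= oppr0 !eqxx.
  move=> e; have {e} : \sum_(l < q) expi2pi ((dd i - dd j)%:~R * (ll l)%:~R / b%:~R) =
      (q%:R : R)%:C * (i == j)%:R.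
    rewrite -e mulrA -rmorphM /= divff ?mul1r //.
  move=> e; split.
    have := congr1 (@complex.Re R) e; rewrite raddf_sum /= => ->.
    by case: (i == j) => /=; rewrite ?mulr0 ?mul0r ?subr0 ?mulr1.
  have := congr1 (@complex.Im R) e; rewrite raddf_sum /= => ->.
  by case: (i == j) => /=; rewrite ?mulr0 ?mul0r ?addr0 ?mulr1.
rewrite sumL.
under eq_bigr do rewrite mask_sqE sumD.
under eq_bigr do under eq_bigr do rewrite sumD.
rewrite -mulr_sumr exchange_big /=.
under eq_bigr do rewrite exchange_big /=.
have row (i : 'I_q) : \sum_(j < q) \sum_(l < q)
    cos (2 * pi * ((x + (ll l)%:~R) / b%:~R) * (dd i - dd j)%:~R) = q%:R.
  rewrite (bigD1 i) //= [X in _ + X]big1 ?addr0 => [|j ji].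
    under eq_bigr do rewrite subrr mulr0 cos0.
    by rewrite sumr_const card_ord.
  have angle l : 2 * pi * ((x + (ll l)%:~R) / b%:~R) * (dd i - dd j)%:~R =
      2 * pi * (x / b%:~R) * (dd i - dd j)%:~R + 2 * pi * ((dd i - dd j)%:~R * (ll l)%:~R / b%:~R).
    by ring.
  under eq_bigr do rewrite angle cosD.
  rewrite sumrB -!mulr_sumr; have [-> ->] := orth i j.
  by rewrite eq_sym (negbTE ji) !mulr0 subrr.
under eq_bigr do rewrite row.
rewrite sumr_const card_ord -[q%:R *+ q]mulr_natl -expr2 mulVf //.
by rewrite expf_neq0.
Qed.

End Mask.

(** * The Fourier transform of the self-similar measure *)

Section SelfSimilarMeasure.
Context (R : realType) (mu : probability (measurableTypeR R) R).
Implicit Types f g : measurableTypeR R -> R.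

Definition bounded_measurable f :=
  measurable_fun [set: measurableTypeR R] f /\ exists C, forall x, `|f x| <= C.

Lemma bounded_measurable_integrable f : bounded_measurable f ->
  mu.-integrable [set: measurableTypeR R] (EFin \o f).
Proof.
move=> [mf [C fC]]; apply: measurable_bounded_integrable => //.
  by rewrite -ge0_fin_numE // fin_num_measure.
exists C; split; first exact: num_real.
by move=> y Cy x _; exact: le_trans (fC x) (ltW Cy).
Qed.

Lemma bounded_measurable_cst r : bounded_measurable (fun=> r).
Proof. by split; [exact: measurable_cst|exists `|r|]. Qed.

Lemma bounded_measurableD f g : bounded_measurable f -> bounded_measurable g ->
  bounded_measurable (fun x => f x + g x).
Proof.
move=> [mf [C fC]] [mg [C' gC]]; split; first exact: measurable_funD.
by exists (C + C') => x; apply: le_trans (ler_normD _ _) (lerD _ _).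
Qed.

Lemma bounded_measurableM f g : bounded_measurable f -> bounded_measurable g ->
  bounded_measurable (fun x => f x * g x).
Proof.
move=> [mf [C fC]] [mg [C' gC]]; split; first exact: measurable_funM.
by exists (C * C') => x; rewrite normrM; apply: ler_pM.
Qed.

Lemma bounded_measurable_cos a : bounded_measurable (fun x => cos (a * x)).
Proof.
split; last by exists 1 => x; rewrite ler_norml cos_geN1 cos_le1.
apply: (@measurableT_comp _ _ _ _ _ _ cos _ ( *%R a)); last exact: measurable_funM.
by apply: continuous_measurable_fun; exact: continuous_cos.
Qed.

Lemma bounded_measurable_sin a : bounded_measurable (fun x => sin (a * x)).
Proof.
split; last by exists 1 => x; rewrite ler_norml sin_geN1 sin_le1.
apply: (@measurableT_comp _ _ _ _ _ _ sin _ ( *%R a)); last exact: measurable_funM.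
by apply: continuous_measurable_fun; exact: continuous_sin.
Qed.

Lemma integral_EFin f : bounded_measurable f ->
  (\int[mu]_x (f x)%:E = (\int[mu]_x f x)%:E)%E.
Proof.
by move=> /bounded_measurable_integrable fi; rewrite /Rintegral fineK // integrable_fin_num.
Qed.

Lemma Rintegral_cst1 r : \int[mu]_x (cst r x) = r.
Proof.
have e : fine (mu [set: measurableTypeR R]) = 1.
  by rewrite (_ : fine _ = fine 1%E) //; congr fine; exact: probability_setT mu.
by rewrite Rintegral_cst // [fine _]e mulr1.
Qed.

Lemma Rintegral_add f g : bounded_measurable f -> bounded_measurable g ->
  \int[mu]_x (f x + g x) = \int[mu]_x f x + \int[mu]_x g x.
Proof. by move=> bf bg; rewrite RintegralD //; exact: bounded_measurable_integrable. Qed.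

Lemma Rintegral_scale r f : bounded_measurable f ->
  \int[mu]_x (r * f x) = r * \int[mu]_x f x.
Proof. by move=> bf; rewrite RintegralZl //; exact: bounded_measurable_integrable. Qed.

Lemma Rintegral_sum (I : Type) (s : seq I) (F : I -> measurableTypeR R -> R) :
  (forall i, bounded_measurable (F i)) ->
  bounded_measurable (fun x => \sum_(i <- s) F i x) /\
  \int[mu]_x (\sum_(i <- s) F i x) = \sum_(i <- s) \int[mu]_x F i x.
Proof.
move=> bF; elim: s => [|i s [bs IH]].
  rewrite big_nil; split.
    by under eq_fun do rewrite big_nil; exact: bounded_measurable_cst.
  by under eq_Rintegral do rewrite big_nil; exact: (Rintegral_cst1 0).
split.
  by under eq_fun do rewrite big_cons; exact: bounded_measurableD.
under eq_Rintegral do rewrite big_cons.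
by rewrite big_cons Rintegral_add // IH.
Qed.

Definition digit_map (b d : int) (x : measurableTypeR R) : measurableTypeR R :=
  (x + d%:~R) / b%:~R.

Lemma measurable_digit_map b d : measurable_fun [set: measurableTypeR R] (digit_map b d).
Proof. by apply: measurable_funM => //; apply: measurable_funD. Qed.

Let digit_image b d : {measure set (measurableTypeR R) -> \bar R} :=
  measure_function_pushforward__canonical__measure_function_Measure mu
    (measurable_digit_map b d).

Context (b : int) (q : nat) (D : {fset int}).
Hypothesis (b_neq0 : b != 0) (hD : #|` D|%fset = q) (hmu : self_similar_measure b D mu).

Lemma ge0_integral_self_similar (f : measurableTypeR R -> \bar R) :
  measurable_fun [set: measurableTypeR R] f -> (forall x, (0 <= f x)%E) ->
  (\int[mu]_x f x = (q%:R^-1)%:E * \sum_(d <- enum_fset D) \int[mu]_x f (digit_map b d x))%E.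
Proof.
move=> mf f0.
pose nu i := digit_image b (nth 0 (enum_fset D) i).
have q0 : 0 <= (q%:R^-1 : R) by rewrite invr_ge0.
rewrite (eq_measure_integral (mscale (NngNum q0) (msum nu q))); last first.
  move=> A mA _; apply: etrans (hmu.2 A mA) _; rewrite hD /mscale /=; congr (_ * _)%E.
  rewrite (big_nth 0) -hD big_mkord; apply: eq_bigr => i _ /=.
  rewrite /pushforward; congr (mu _); apply/seteqP; split => [_ [x Ax <-]|x /= Ax] /=.
    by rewrite /digit_map subrK mulrC mulKf // intr_eq0.
  by exists (digit_map b (enum_fset D)`_i x) => //; rewrite /digit_map mulrC divfK ?addrK // intr_eq0.
rewrite ge0_integral_mscale //; congr (_ * _)%E.
rewrite ge0_integral_measure_sum // (big_nth 0) -hD big_mkord; apply: eq_bigr => i _.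
rewrite ge0_integral_pushforward ?preimage_setT //.
exact: measurable_digit_map.
Qed.

Lemma Rintegral_self_similar f : bounded_measurable f ->
  \int[mu]_x f x = q%:R^-1 * \sum_(d <- enum_fset D) \int[mu]_x f (digit_map b d x).
Proof.
move=> bf; have [mf [C fC]] := bf.
have bfd d : bounded_measurable (f \o digit_map b d).
  by split; [exact: measurableT_comp (measurable_digit_map b d)|exists C => x; exact: fC].
have q0 : q%:R != 0 :> R.
  have [_ h] := hmu; rewrite pnatr_eq0; apply/eqP => q0.
  have := h setT measurableT; rewrite hD q0 invr0 mul0e => e.
  have /eqP := etrans (esym (probability_setT mu)) e.
  by rewrite eqe oner_eq0.
have shift g : bounded_measurable g -> (\int[mu]_x (g x + C)%:E = (\int[mu]_x g x + C)%:E)%E.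
  move=> bg; have bC := bounded_measurable_cst C.
  by rewrite integral_EFin ?Rintegral_add ?Rintegral_cst1 //; exact: bounded_measurableD.
have := @ge0_integral_self_similar (fun x => (f x + C)%:E) _ _.
rewrite shift // => h.
have {}h : (\int[mu]_x f x + C)%:E = ((q%:R^-1)%:E * \sum_(d <- enum_fset D)
    (\int[mu]_x f (digit_map b d x) + C)%:E)%E.
  rewrite h; last 2 first.
  - by apply/measurable_EFinP; apply: measurable_funD.
  - by move=> x; rewrite lee_fin; have := fC x; rewrite ler_norml; lra.
  congr (_ * _)%E; apply: eq_bigr => d _; exact: shift (bfd d).
move: h; rewrite sumEFin -EFinM => -[]; rewrite big_split /= mulrDr.
rewrite big_const_seq count_predT hD iter_addr_0 -[C *+ q]mulr_natl mulrA mulVf // mul1r.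
by move/addIr.
Qed.

Definition fourier_cos (x : R) := \int[mu]_y cos (2 * pi * x * y).
Definition fourier_sin (x : R) := \int[mu]_y sin (2 * pi * x * y).
Definition fourier_sq (x : R) := fourier_cos x ^+ 2 + fourier_sin x ^+ 2.
Local Notation mask_cos := (mask_cos q D).
Local Notation mask_sin := (mask_sin q D).
Local Notation mask_sq := (mask_sq q D).

Let bc := bounded_measurable_cos.
Let bs := bounded_measurable_sin.

Lemma Rintegral_sub f g : bounded_measurable f -> bounded_measurable g ->
  \int[mu]_x (f x - g x) = \int[mu]_x f x - \int[mu]_x g x.
Proof. by move=> bf bg; rewrite RintegralB //; exact: bounded_measurable_integrable. Qed.

Lemma bounded_measurable_scale r f : bounded_measurable f ->
  bounded_measurable (fun x => r * f x).
Proof. by move=> bf; apply: bounded_measurableM => //; exact: bounded_measurable_cst. Qed.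

Lemma bounded_measurable_sub f g : bounded_measurable f -> bounded_measurable g ->
  bounded_measurable (fun x => f x - g x).
Proof.
move=> bf bg; under eq_fun do rewrite -mulN1r.
exact: bounded_measurableD (bounded_measurable_scale _ bg).
Qed.

Let b0 : b%:~R != 0 :> R. Proof. by rewrite intr_eq0. Qed.

Let digit_angle (x y : R) d :
  2 * pi * x * digit_map b d y = 2 * pi * (x / b%:~R) * d%:~R + 2 * pi * (x / b%:~R) * y.
Proof. by rewrite /digit_map; field. Qed.

Lemma fourier_cos_scale x : fourier_cos x =
  mask_cos (x / b%:~R) * fourier_cos (x / b%:~R)
  - mask_sin (x / b%:~R) * fourier_sin (x / b%:~R).
Proof.
rewrite {1}/fourier_cos Rintegral_self_similar; last exact: bc.
rewrite /mask_cos /mask_sin -[_ * _ * fourier_cos _]mulrA -[_ * _ * fourier_sin _]mulrA -mulrBr; congr (_ * _).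
rewrite !mulr_suml -sumrB; apply: eq_bigr => d _.
under eq_Rintegral do rewrite /= digit_angle cosD.
by rewrite Rintegral_sub ?Rintegral_scale //; exact: bounded_measurable_scale.
Qed.

Lemma fourier_sin_scale x : fourier_sin x =
  mask_sin (x / b%:~R) * fourier_cos (x / b%:~R)
  + mask_cos (x / b%:~R) * fourier_sin (x / b%:~R).
Proof.
rewrite {1}/fourier_sin Rintegral_self_similar; last exact: bs.
rewrite /mask_cos /mask_sin -[_ * _ * fourier_cos _]mulrA -[_ * _ * fourier_sin _]mulrA -mulrDr; congr (_ * _).
rewrite !mulr_suml -big_split /=; apply: eq_bigr => d _.
under eq_Rintegral do rewrite /= digit_angle sinD.
by rewrite Rintegral_add ?Rintegral_scale //; exact: bounded_measurable_scale.
Qed.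

Lemma fourier_sq_scale x :
  fourier_sq x = mask_sq (x / b%:~R) * fourier_sq (x / b%:~R).
Proof. by rewrite /fourier_sq (fourier_cos_scale x) (fourier_sin_scale x) /mask_sq; ring. Qed.

Lemma fourier_sq_ge0 x : 0 <= fourier_sq x.
Proof. by rewrite addr_ge0 ?sqr_ge0. Qed.

Lemma fourier_cos0 : fourier_cos 0 = 1.
Proof.
rewrite /fourier_cos; under eq_Rintegral do rewrite mulr0 mul0r cos0.
exact: (Rintegral_cst1 1).
Qed.

Lemma fourier_sin0 : fourier_sin 0 = 0.
Proof.
rewrite /fourier_sin; under eq_Rintegral do rewrite mulr0 mul0r sin0.
exact: (Rintegral_cst1 0).
Qed.

Lemma fourier_sq0 : fourier_sq 0 = 1.
Proof. by rewrite /fourier_sq fourier_cos0 fourier_sin0; ring. Qed.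

Lemma fourier_cosN x : fourier_cos (- x) = fourier_cos x.
Proof. by apply: eq_Rintegral => y _; rewrite mulrN mulNr cosN. Qed.

Lemma fourier_sinN x : fourier_sin (- x) = - fourier_sin x.
Proof.
rewrite -[RHS]mulN1r /fourier_sin -Rintegral_scale //.
by apply: eq_Rintegral => y _; rewrite mulrN mulNr sinN mulN1r.
Qed.

Lemma fourier_sqN x : fourier_sq (- x) = fourier_sq x.
Proof. by rewrite /fourier_sq fourier_cosN fourier_sinN sqrrN. Qed.

(** The variance of the unimodular function being averaged is nonnegative. *)
Lemma fourier_sq_le1 x : fourier_sq x <= 1.
Proof.
set u := fourier_cos x; set v := fourier_sin x.
have : 0 <= \int[mu]_y ((1 + u ^+ 2 + v ^+ 2) - (2 * u) * cos (2 * pi * x * y)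
    - (2 * v) * sin (2 * pi * x * y)).
  apply: Rintegral_ge0 => y _.
  set c := cos _; set s := sin _; have cs : c ^+ 2 + s ^+ 2 = 1 by exact: cos2Dsin2.
  have : 0 <= (c - u) ^+ 2 + (s - v) ^+ 2 by rewrite addr_ge0 ?sqr_ge0.
  by rewrite (_ : _ + _ = c ^+ 2 + s ^+ 2 + u ^+ 2 + v ^+ 2 - 2 * u * c - 2 * v * s); [lra|ring].
have b1 := bounded_measurable_cst (1 + u ^+ 2 + v ^+ 2).
have bu := bounded_measurable_scale (2 * u) (bc (2 * pi * x)).
have bv := bounded_measurable_scale (2 * v) (bs (2 * pi * x)).
have b1u := bounded_measurable_sub b1 bu.
rewrite !Rintegral_sub // !Rintegral_scale //.
have -> : \int[mu]_y (1 + u ^+ 2 + v ^+ 2) = 1 + u ^+ 2 + v ^+ 2 by exact: Rintegral_cst1.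
by rewrite -/(fourier_cos x) -/(fourier_sin x) -/u -/v /fourier_sq -/u -/v; lra.
Qed.

Lemma exists_support_interval : exists T : R, 0 < T /\
  mu (`[- T, T]%classic : set (measurableTypeR R)) = 1%E.
Proof.
have [[K [cK muK]] _] := hmu.
have [T0 [_ hT0]] := compact_bounded cK.
exists (`|T0| + 1); split; first by rewrite ltr_wpDl.
apply/eqP; rewrite eq_le probability_le1 /=; last exact: measurable_itv.
rewrite -muK; apply: le_measure; rewrite ?inE.
- exact: compact_measurable.
- exact: measurable_itv.
- move=> x Kx; rewrite /= in_itv /= -ler_norml; move: x Kx.
  by apply: hT0; rewrite (le_lt_trans (ler_norm _)) // ltrDl.
Qed.

Lemma exists_support_bound : exists T : R, 0 < T /\
  forall f C, bounded_measurable f -> (forall x : R, `|x| <= T -> f x <= C) ->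
    \int[mu]_x f x <= C.
Proof.
have [T [T_gt0 muS]] := exists_support_interval.
set S : set (measurableTypeR R) := `[- T, T]%classic in muS.
have mS : measurable S by exact: measurable_itv.
have muSC : mu (~` S) = 0%E by rewrite probability_setC // muS subee.
exists T; split => // f C bf fC.
have fi := bounded_measurable_integrable bf.
have mSC : measurable (~` S) by exact: measurableC.
have fiS A : measurable A -> mu.-integrable A (EFin \o f).
  by move=> mA; exact: integrableS fi.
have int_le A C1 : measurable A -> (forall x, A x -> f x <= C1) ->
    \int[mu]_(x in A) f x <= C1 * fine (mu A).
  move=> mA le1; rewrite -Rintegral_cst //; apply: le_Rintegral => //; first exact: fiS.
  exact: integrableS (bounded_measurable_integrable (bounded_measurable_cst C1)).
have [_ [C2 fC2]] := bf.
rewrite -(setUv S) Rintegral_setU //; last 2 first.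
- by rewrite setUv.
- by rewrite disj_set2E; apply/eqP; rewrite setICr.
have h1 : \int[mu]_(x in S) f x <= C.
  have := int_le S C mS; rewrite [fine _](congr1 fine muS) mulr1; apply => x.
  by rewrite /S /= in_itv /= -ler_norml; exact: fC.
have h2 : \int[mu]_(x in ~` S) f x <= 0.
  have := int_le (~` S) C2 mSC; rewrite [fine _](congr1 fine muSC) mulr0.
  by apply => x _; exact: le_trans (ler_norm _) (fC2 x).
by rewrite -[C]addr0; exact: lerD.
Qed.

Lemma fourier_sq_lipschitz : exists K : R, 0 < K /\
  forall x y, `|fourier_sq x - fourier_sq y| <= K * `|x - y|.
Proof.
have [T [T0 hT]] := exists_support_bound.
pose K1 : R := 2 * pi * T.
have K10 : 0 < K1 by rewrite !mulr_gt0 // pi_gt0.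
have angle (x y z : R) : `|z| <= T ->
    `|2 * pi * x * z - 2 * pi * y * z| <= K1 * `|x - y|.
  move=> zT; rewrite -mulrBl -mulrBr !normrM (gtr0_norm (pi_gt0 R)) ger0_norm // /K1.
  rewrite mulrAC -!mulrA !ler_pM2l ?pi_gt0 // mulrC [T * _]mulrC.
  by rewrite ler_wpM2l.
have one x y : fourier_cos x - fourier_cos y <= K1 * `|x - y| /\
               fourier_sin x - fourier_sin y <= K1 * `|x - y|.
  split; rewrite -Rintegral_sub //; apply: hT; try exact: bounded_measurable_sub.
    move=> z /(angle x y); apply: le_trans; apply: le_trans (ler_norm _) _.
    exact: cos_lipschitz.
  move=> z /(angle x y); apply: le_trans; apply: le_trans (ler_norm _) _.
  exact: sin_lipschitz.
have bound x : `|fourier_cos x| <= 1 /\ `|fourier_sin x| <= 1.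
  have := fourier_sq_le1 x; rewrite /fourier_sq => h.
  by split; rewrite -[1](@normr1 R) -ler_sqr ?normr_nneg // !real_normK ?num_real // expr1n;
    have := sqr_ge0 (fourier_cos x); have := sqr_ge0 (fourier_sin x); lra.
exists (4 * K1); split; first by rewrite mulr_gt0.
move=> x y; have [c1 s1] := one x y; have [c2 s2] := one y x.
rewrite (distrC y x) in c2 s2.
have [bx bx'] := bound x; have [by_ by'] := bound y.
have cc : `|fourier_cos x - fourier_cos y| <= K1 * `|x - y| by rewrite ler_norml; lra.
have ss : `|fourier_sin x - fourier_sin y| <= K1 * `|x - y| by rewrite ler_norml; lra.
have -> : fourier_sq x - fourier_sq y =
    (fourier_cos x - fourier_cos y) * (fourier_cos x + fourier_cos y)
    + (fourier_sin x - fourier_sin y) * (fourier_sin x + fourier_sin y).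
  by rewrite /fourier_sq; ring.
have half (u v : R) : `|u| <= 1 -> `|v| <= 1 -> `|u + v| <= 2.
  by move=> h1 h2; apply: le_trans (ler_normD _ _) _; lra.
apply: le_trans (ler_normD _ _) _; rewrite !normrM.
have := ler_pM (normr_ge0 _) (normr_ge0 _) cc (half _ _ bx by_).
have := ler_pM (normr_ge0 _) (normr_ge0 _) ss (half _ _ bx' by').
lra.
Qed.

End SelfSimilarMeasure.

(** * The period group and the spectral data *)

Section PeriodGroup.
Context (R : realType) (q : nat) (D : {fset int}).
Local Notation Gam := (@period_group R D).

Lemma period_group0 : Gam 0.
Proof. by move=> d _; exists 0; rewrite mul0r. Qed.

Lemma period_groupD x y : Gam x -> Gam y -> Gam (x + y).
Proof.
move=> gx gy d dD; have [z ez] := gx d dD; have [z' ez'] := gy d dD.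
by exists (z + z'); rewrite mulrDl ez ez' intrD.
Qed.

Lemma period_groupN x : Gam x -> Gam (- x).
Proof. by move=> gx d /gx[z ez]; exists (- z); rewrite mulNr ez mulrNz. Qed.

Lemma period_group_int (z : int) : Gam z%:~R.
Proof. by move=> d _; exists (z * d); rewrite intrM. Qed.

(** A nonzero digit [d] confines the periods to the multiples of [d^-1]. *)
Lemma period_group_discrete : (1 < q)%N -> #|` D|%fset = q ->
  exists g0, [/\ Gam g0, 0 < g0 & forall x, Gam x -> x != 0 -> g0 <= `|x|].
Proof.
move=> q1 hD; have [d dD d0] : exists2 d, d \in D & d != 0.
  apply: contrapT => h; have : (size (enum_fset D) <= size [:: 0%R : int])%N.
    apply: uniq_leq_size; first exact: fset_uniq.
    move=> d dD; rewrite inE; apply: contrapT => /negP dn; apply: h.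
    by exists d.
  by rewrite hD /= leqNgt q1.
have d'0 : 0 < `|d%:~R| :> R by rewrite normr_gt0 intr_eq0.
pose P n := (0 < n)%N && `[< Gam (n%:R / `|d%:~R|) >].
have exP : exists n, P n.
  exists `|d|%N; rewrite /P absz_gt0 d0; apply/asboolP.
  have -> : (`|d|%N)%:R / `|d%:~R| = 1 :> R.
    by rewrite natr_absz intr_norm divff // gt_eqF.
  exact: (period_group_int 1).
case: (ex_minnP exP) => n /andP[n0 /asboolP Gn] nmin.
exists (n%:R / `|d%:~R|); split => //; first by rewrite divr_gt0 // ltr0n.
move=> x gx x0; have [z ez] := gx d dD.
have xz : `|x| = (absz z)%:R / `|d%:~R|.
  by rewrite natr_absz intr_norm -ez normrM mulfK // gt_eqF.
have z0 : z != 0.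
  by apply: contra_neq x0 => z0; move: ez; rewrite z0 => /eqP; rewrite mulf_eq0 intr_eq0 (negbTE d0) orbF => /eqP.
rewrite xz ler_pM2r ?invr_gt0 // ler_nat; apply: nmin.
rewrite /P absz_gt0 z0 /=; apply/asboolP; rewrite -xz.
by case: (ger0P x) => _ //; exact: period_groupN.
Qed.
End PeriodGroup.

(** The Fourier transform of the measure and the mask of its digit set satisfy
    the axioms from which the frequencies are constructed.  The columns of the
    Hadamard matrix are translated so that [0] becomes one of them. *)
Lemma self_similar_data (R : realType) (b q : nat) (D L : {fset int})
    (mu : probability (measurableTypeR R) R) :
  (2 <= q)%N -> (q < b)%N -> 0 \in D -> #|` D|%fset = q ->
  hadamard_triple R b D L -> self_similar_measure b D mu ->
  exists g0 K Ls, self_similar_spectral_data b q (@period_group R D) g0 K Ls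
    (mask_sq q D) (fourier_sq mu).
Proof.
move=> q2 qb D0 hD hL hmu.
have b0 : (b%:Z != 0)%R by rewrite -lt0n; apply: leq_trans qb.
have [K [K0 lip]] := fourier_sq_lipschitz hmu.
have [g0 [Gg0 g00 gdisc]] := period_group_discrete R q2 hD.
pose l0 := nth 0 (enum_fset L) 0.
have szL := (mask_sq_sum q2 hD (0 : R) hL).1.
have l0L : l0 \in enum_fset L by rewrite mem_nth // szL ltnW.
exists g0, K, [seq (l - l0)%:~R | l <- enum_fset L]; split => //.
- exact: period_group0.
- exact: period_groupD.
- exact: period_groupN.
- exact: period_group_int.
- by rewrite size_map.
- by apply/mapP; exists l0 => //; rewrite subrr.
- by move=> _ /mapP[l _ ->]; exists (l - l0).
- by move=> x; rewrite addr_ge0 ?sqr_ge0.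
- by move=> x g; exact: mask_sq_periodic.
- by move=> x; exact: mask_sq_eq1.
- exact: mask_sq_zeros.
- move=> x; rewrite big_map -[RHS](mask_sq_sum q2 hD (x - l0%:~R) hL).2.
  by apply: eq_bigr => l _; rewrite intrB; congr (mask_sq _ _ (_ / _)); ring.
- exact: fourier_sq_ge0.
- exact: fourier_sq_le1.
- exact: fourier_sq0.
- exact: fourier_sqN.
- by move=> x; exact: (fourier_sq_scale b0 hD hmu).
Qed.

(** * The closed span of the exponentials *)

Section ExponentialClosure.
Context (R : realType) (mu : probability (measurableTypeR R) R) (Lam : set R).
Local Notation T := (measurableTypeR R).
Implicit Types (f g : T -> R[i]) (z w : R[i]) (l : R).
Local Open Scope complex_scope.

Definition sqn z : R := complex.Re z ^+ 2 + complex.Im z ^+ 2.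

Lemma sqn_ge0 z : 0 <= sqn z.
Proof. by rewrite addr_ge0 ?sqr_ge0. Qed.

Lemma sqnM z w : sqn (z * w) = sqn z * sqn w.
Proof. by case: z w => [a b] [c d]; rewrite /sqn /=; ring. Qed.

Lemma sqnD_le z w : sqn (z + w) <= 2 * sqn z + 2 * sqn w.
Proof.
case: z w => [a b] [c d]; rewrite /sqn /=.
have := sqr_ge0 (a - c); have := sqr_ge0 (b - d); lra.
Qed.

Definition cmeasurable f := measurable_fun [set: T] (fun x => complex.Re (f x)) /\
  measurable_fun [set: T] (fun x => complex.Im (f x)).

Lemma cmeasurableD f g : cmeasurable f -> cmeasurable g ->
  cmeasurable (fun x => f x + g x).
Proof.
move=> [f1 f2] [g1 g2]; split.
  rewrite (_ : (fun x => _) = (fun x => complex.Re (f x)) \+ (fun x => complex.Re (g x))).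
    exact: measurable_funD.
  by apply/funext => x /=; case: (f x) (g x) => [a b] [c d].
rewrite (_ : (fun x => _) = (fun x => complex.Im (f x)) \+ (fun x => complex.Im (g x))).
  exact: measurable_funD.
by apply/funext => x /=; case: (f x) (g x) => [a b] [c d].
Qed.

Lemma cmeasurableM f g : cmeasurable f -> cmeasurable g ->
  cmeasurable (fun x => f x * g x).
Proof.
move=> [f1 f2] [g1 g2]; split.
  rewrite (_ : (fun x => _) = ((fun x => complex.Re (f x)) \* (fun x => complex.Re (g x)))
     \- ((fun x => complex.Im (f x)) \* (fun x => complex.Im (g x)))).
    by apply: measurable_funB; exact: measurable_funM.
  by apply/funext => x /=; case: (f x) (g x) => [a b] [c d].
rewrite (_ : (fun x => _) = ((fun x => complex.Re (f x)) \* (fun x => complex.Im (g x)))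
   \+ ((fun x => complex.Im (f x)) \* (fun x => complex.Re (g x)))).
  by apply: measurable_funD; exact: measurable_funM.
by apply/funext => x /=; case: (f x) (g x) => [a b] [c d].
Qed.

Lemma cmeasurable_cst z : cmeasurable (fun=> z).
Proof. by split; exact: measurable_cst. Qed.

Lemma cmeasurable_real (u : T -> R) : measurable_fun [set: T] u ->
  cmeasurable (fun x => (u x)%:C).
Proof. by move=> mu_; split => //=; exact: measurable_cst. Qed.

Lemma cmeasurableN f : cmeasurable f -> cmeasurable (fun x => - f x).
Proof.
move=> mf; under eq_fun do rewrite -mulN1r.
exact: cmeasurableM (cmeasurable_cst _) mf.
Qed.

Lemma cmeasurable_sub f g : cmeasurable f -> cmeasurable g ->
  cmeasurable (fun x => f x - g x).
Proof. by move=> mf mg; apply: cmeasurableD => //; exact: cmeasurableN. Qed.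

Lemma measurable_sqn f : cmeasurable f -> measurable_fun [set: T] (fun x => sqn (f x)).
Proof.
by move=> [f1 f2]; apply: measurable_funD; apply: measurable_funX.
Qed.

(** The squared norm in the space of square integrable functions. *)
Definition sqnorm f : \bar R := (\int[mu]_x (sqn (f x))%:E)%E.

Lemma sqnorm_ge0 f : (0 <= sqnorm f)%E.
Proof. by apply: integral_ge0 => x _; rewrite lee_fin sqn_ge0. Qed.

Lemma sqnormD_le f g : cmeasurable f -> cmeasurable g ->
  (sqnorm (fun x => f x + g x)%R <= 2%:E * sqnorm f + 2%:E * sqnorm g)%E.
Proof.
move=> mf mg.
have h u : cmeasurable u -> (2%:E * sqnorm u = \int[mu]_x (2 * sqn (u x))%:E)%E.
  move=> mu_; rewrite /sqnorm -ge0_integralZl_EFin //.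
  - by move=> x _; rewrite lee_fin sqn_ge0.
  - by apply/measurable_EFinP; exact: measurable_sqn.
rewrite !h // -ge0_integralD //; first last.
- by apply/measurable_EFinP; apply: measurable_funM => //; exact: measurable_sqn.
- by move=> x _; rewrite lee_fin mulr_ge0 ?sqn_ge0.
- by apply/measurable_EFinP; apply: measurable_funM => //; exact: measurable_sqn.
- by move=> x _; rewrite lee_fin mulr_ge0 ?sqn_ge0.
apply: ge0_le_integral => //.
- by move=> x _; rewrite lee_fin sqn_ge0.
- by apply/measurable_EFinP; apply: measurable_sqn; exact: cmeasurableD.
- apply/measurable_EFinP; apply: measurable_funD; apply: measurable_funM => //;
    exact: measurable_sqn.
- by move=> x _; rewrite -EFinD lee_fin; exact: sqnD_le.
Qed.

Lemma sqnormZ z f : cmeasurable f ->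
  sqnorm (fun x => z * f x) = ((sqn z)%:E * sqnorm f)%E.
Proof.
move=> mf; rewrite /sqnorm -ge0_integralZl_EFin ?sqn_ge0 //.
- by apply: eq_integral => x _; rewrite sqnM EFinM.
- by move=> x _; rewrite lee_fin sqn_ge0.
- by apply/measurable_EFinP; exact: measurable_sqn.
Qed.

Definition exp_sum (ps : seq (R * R[i])) (x : T) : R[i] :=
  \sum_(p <- ps) p.2 * exponential p.1 x.

Lemma cmeasurable_exp_sum ps : cmeasurable (exp_sum ps).
Proof.
elim: ps => [|p ps IH].
  by rewrite (_ : exp_sum _ = fun=> 0); [exact: cmeasurable_cst|apply/funext => x; rewrite /exp_sum big_nil].
rewrite (_ : exp_sum _ = fun x => p.2 * exponential p.1 x + exp_sum ps x); last first.
  by apply/funext => x; rewrite /exp_sum big_cons.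
apply: cmeasurableD => //; apply: cmeasurableM; first exact: cmeasurable_cst.
split.
  rewrite (_ : (fun x => _) = fun x : T => cos (2 * pi * p.1 * x)); last first.
    by apply/funext => x /=; rewrite mulrA.
  by have [] := bounded_measurable_cos (2 * pi * p.1).
rewrite (_ : (fun x => _) = fun x : T => sin (2 * pi * p.1 * x)); last first.
  by apply/funext => x /=; rewrite mulrA.
by have [] := bounded_measurable_sin (2 * pi * p.1).
Qed.

(** The closed linear span of the exponentials in the space of square
    integrable functions. *)
Definition in_closure f := cmeasurable f /\ forall eps : R, 0 < eps ->
  exists ps, (forall p, p \in ps -> Lam p.1) /\
    (sqnorm (fun x => f x - exp_sum ps x)%R < eps%:E)%E.

Lemma sqnorm_sub_lt f g h (eps : R) : cmeasurable f -> cmeasurable g -> cmeasurable h ->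
  (sqnorm (fun x => f x - g x)%R < (eps / 4)%:E)%E ->
  (sqnorm (fun x => g x - h x)%R < (eps / 4)%:E)%E ->
  (sqnorm (fun x => f x - h x)%R < eps%:E)%E.
Proof.
move=> mf mg mh fg gh.
rewrite (_ : (fun x => _) = (fun x => (f x - g x) + (g x - h x))); last first.
  by apply/funext => x; rewrite addrA subrK.
apply: le_lt_trans (sqnormD_le (cmeasurable_sub mf mg) (cmeasurable_sub mg mh)) _.
have -> : eps%:E = (2%:E * (eps / 4)%:E + 2%:E * (eps / 4)%:E)%E :> \bar R.
  by rewrite -!EFinM -EFinD; congr EFin; field.
by apply: lteD; rewrite lte_pmul2l ?lte_fin.
Qed.

Lemma in_closure_closed f : cmeasurable f ->
  (forall eps : R, 0 < eps -> exists g, in_closure g /\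
    (sqnorm (fun x => f x - g x)%R < eps%:E)%E) -> in_closure f.
Proof.
move=> mf h; split => // eps eps0; have e4 : 0 < eps / 4 by rewrite divr_gt0.
have [g [[mg cg] fg]] := h _ e4; have [ps [psL gps]] := cg _ e4.
exists ps; split => //; exact: sqnorm_sub_lt mf mg (cmeasurable_exp_sum ps) fg gps.
Qed.

Lemma in_closureD f g : in_closure f -> in_closure g ->
  in_closure (fun x => f x + g x).
Proof.
move=> [mf cf] [mg cg]; split; first exact: cmeasurableD.
move=> eps eps0; have e4 : 0 < eps / 4 by rewrite divr_gt0.
have [ps [psL fps]] := cf _ e4; have [qs [qsL gqs]] := cg _ e4.
exists (ps ++ qs); split.
  by move=> p; rewrite mem_cat => /orP[/psL|/qsL].
rewrite (_ : (fun x => _) = (fun x => (f x - exp_sum ps x) + (g x - exp_sum qs x))); last first.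
  by apply/funext => x; rewrite /exp_sum big_cat /= opprD addrACA.
have mp := cmeasurable_exp_sum ps; have mq := cmeasurable_exp_sum qs.
apply: le_lt_trans (sqnormD_le (cmeasurable_sub mf mp) (cmeasurable_sub mg mq)) _.
have -> : eps%:E = (2%:E * (eps / 4)%:E + 2%:E * (eps / 4)%:E)%E :> \bar R.
  by rewrite -!EFinM -EFinD; congr EFin; field.
by apply: lteD; rewrite lte_pmul2l ?lte_fin.
Qed.

Lemma in_closureZ z f : in_closure f -> in_closure (fun x => z * f x).
Proof.
move=> [mf cf]; split; first exact: cmeasurableM (cmeasurable_cst z) mf.
move=> eps eps0; have z1 : 0 < sqn z + 1 by rewrite ltr_wpDl // sqn_ge0.
have e1 : 0 < eps / (sqn z + 1) by rewrite divr_gt0.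
have [ps [psL fps]] := cf _ e1.
exists [seq (p.1, z * p.2) | p <- ps]; split.
  by move=> _ /mapP[p /psL pL ->].
rewrite (_ : (fun x => _) = (fun x => z * (f x - exp_sum ps x))); last first.
  apply/funext => x; rewrite mulrBr /exp_sum big_map mulr_sumr; congr (_ - _).
  by apply: eq_bigr => p _; rewrite mulrA.
rewrite sqnormZ; last exact: cmeasurable_sub mf (cmeasurable_exp_sum ps).
apply: (@le_lt_trans _ _ ((sqn z)%:E * (eps / (sqn z + 1))%:E)%E).
  by apply: lee_wpmul2l; rewrite ?lee_fin ?sqn_ge0 // ltW.
by rewrite -EFinM lte_fin mulrCA gtr_pMr // ltr_pdivrMr // mul1r ltrDl.
Qed.

Lemma in_closure0 : in_closure (fun=> 0).
Proof.
split; first exact: cmeasurable_cst.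
move=> eps eps0; exists [::]; split => //.
rewrite /sqnorm (eq_integral (fun=> 0%E)) ?integral0 ?lte_fin // => x _.
by rewrite /exp_sum big_nil subrr /sqn /= expr0n /= addr0.
Qed.

Lemma in_closure_sum (I : Type) (s : seq I) (F : I -> T -> R[i]) :
  (forall i, in_closure (F i)) -> in_closure (fun x => \sum_(i <- s) F i x).
Proof.
move=> cF; elim: s => [|i s IH].
  by under eq_fun do rewrite big_nil; exact: in_closure0.
by under eq_fun do rewrite big_cons; exact: in_closureD.
Qed.

Lemma in_closure_dominated (F : nat -> T -> R[i]) f (G : T -> R) :
  (forall n, in_closure (F n)) -> cmeasurable f ->
  mu.-integrable [set: T] (EFin \o G) ->
  {ae mu, forall x, sqn (f x - F n x) @[n --> \oo] --> (0 : R)} ->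
  (forall n x, sqn (f x - F n x) <= G x) ->
  in_closure f.
Proof.
move=> cF mf iG cvF domF; apply: in_closure_closed => // eps eps0.
have mF n : cmeasurable (fun x => f x - F n x).
  by apply: cmeasurable_sub => //; have [] := cF n.
pose u n x := (sqn (f x - F n x))%:E.
have mu_ n : measurable_fun [set: T] (u n).
  by apply/measurable_EFinP; exact: measurable_sqn (mF n).
have cvu : {ae mu, forall x, [set: T] x -> u ^~ x @ \oo --> (cst 0%E : T -> \bar R) x}.
  by apply: filterS cvF => x cx _; apply/cvg_EFin; [exact: nearW|exact: cx].
have domu : {ae mu, forall x n, [set: T] x -> (`|u n x| <= (EFin \o G) x)%E}.
  apply: aeW => x n _; rewrite /u /= lee_fin ger0_norm ?sqn_ge0 //.
have [_ _ lim] := dominated_convergence measurableT mu_ (measurable_cst _) cvu iG domu.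
rewrite integral0 in lim.
have /fine_cvgP[fin lim'] := lim.
have [N _ hN] : \forall n \near \oo, `|0 - fine (\int[mu]_x u n x)%E| < eps /\
    (\int[mu]_x u n x)%E \is a fin_num.
  near=> n; split; last by near: n; exact: fin.
  by near: n; move/cvgrPdist_lt : lim'; exact.
have [lt fn] := hN N (leqnn N).
exists (F N); split => //; rewrite /sqnorm -(fineK fn) lte_fin.
by move: lt; rewrite sub0r normrN; exact: le_lt_trans (ler_norm _).
Unshelve. all: by end_near.
Qed.

End ExponentialClosure.

Section ExponentialSums.
Context (R : realType) (mu : probability (measurableTypeR R) R).
Local Notation T := (measurableTypeR R).
Local Open Scope complex_scope.
Local Notation exp_sum := (@exp_sum R).

Lemma exponentialD (k l : R) (x : T) :
  exponential (k + l) x = exponential k x * exponential l x.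
Proof. by rewrite /exponential mulrDl expi2piD. Qed.

Definition exp_sum_mul (ps qs : seq (R * R[i])) :=
  [seq (p.1 + r.1, p.2 * r.2) | p <- ps, r <- qs].

Lemma exp_sumM ps qs x : exp_sum (exp_sum_mul ps qs) x = exp_sum ps x * exp_sum qs x.
Proof.
rewrite /exp_sum /exp_sum_mul big_allpairs_dep mulr_suml; apply: eq_bigr => p _.
rewrite mulr_sumr; apply: eq_bigr => r _.
by rewrite /= exponentialD mulrACA.
Qed.

Definition exp_sum_conj (ps : seq (R * R[i])) := [seq (- p.1, Num.conj p.2) | p <- ps].

Lemma exp_sum_conjE ps x : exp_sum (exp_sum_conj ps) x = Num.conj (exp_sum ps x).
Proof.
rewrite /exp_sum big_map rmorph_sum; apply: eq_bigr => p _.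
by rewrite rmorphM /exponential /= expi2pi_conj mulNr.
Qed.

Lemma sqn_conj (z : R[i]) : (sqn z)%:C = z * Num.conj z.
Proof.
by case: z => a b; apply/eqP; rewrite eq_complex /sqn /=; apply/andP; split; apply/eqP; ring.
Qed.

(** The Fourier transform of the measure at [- x]. *)
Definition fourier_hat (x : R) : R[i] := fourier_cos mu x +i* fourier_sin mu x.

Lemma fourier_hat_conj x : Num.conj (fourier_hat x) = fourier_hat (- x).
Proof.
by apply/eqP; rewrite eq_complex /= fourier_cosN fourier_sinN !eqxx.
Qed.

Lemma Rintegral_Re_exp_sum ps :
  bounded_measurable (fun x : T => complex.Re (exp_sum ps x)) /\
  \int[mu]_x complex.Re (exp_sum ps x) = complex.Re (\sum_(p <- ps) p.2 * fourier_hat p.1).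
Proof.
have term p : (fun x : T => complex.Re (p.2 * exponential p.1 x)) =
    fun x => complex.Re p.2 * cos (2 * pi * p.1 * x) - complex.Im p.2 * sin (2 * pi * p.1 * x).
  by apply/funext => x; case: p.2 => a b /=; rewrite !mulrA.
have bterm p : bounded_measurable (fun x : T => complex.Re (p.2 * exponential p.1 x)).
  rewrite term; apply: bounded_measurable_sub; apply: bounded_measurable_scale;
    [exact: bounded_measurable_cos|exact: bounded_measurable_sin].
have [bS iS] := Rintegral_sum mu ps bterm.
have e : (fun x : T => complex.Re (exp_sum ps x)) =
    fun x => \sum_(p <- ps) complex.Re (p.2 * exponential p.1 x).
  by apply/funext => x; rewrite /exp_sum raddf_sum.
rewrite e; split => //; rewrite iS raddf_sum; apply: eq_bigr => p _.
rewrite term Rintegral_sub ?Rintegral_scale; first by case: p.2.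
- exact: bounded_measurable_sin.
- exact: bounded_measurable_cos.
- exact/bounded_measurable_scale/bounded_measurable_cos.
- exact/bounded_measurable_scale/bounded_measurable_sin.
Qed.

Lemma sqnorm_exp_sum ps : sqnorm mu (exp_sum ps) =
  (complex.Re (\sum_(p <- ps) \sum_(r <- ps) p.2 * Num.conj r.2 * fourier_hat (p.1 - r.1)))%:E.
Proof.
have [bm e] := Rintegral_Re_exp_sum (exp_sum_mul ps (exp_sum_conj ps)).
rewrite /sqnorm (eq_integral (fun x : T => (complex.Re (exp_sum (exp_sum_mul ps (exp_sum_conj ps)) x))%:E)).
  rewrite integral_EFin // e; congr EFin; congr complex.Re.
  rewrite /exp_sum_mul big_allpairs_dep; apply: eq_bigr => p _.
  by rewrite /exp_sum_conj big_map.
by move=> x _; rewrite exp_sumM exp_sum_conjE -sqn_conj.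
Qed.

Context (Lam : set R).
Hypothesis orth : forall k l, Lam k -> Lam l -> k != l -> fourier_sq mu (k - l) = 0.
Hypothesis parseval : forall x (eps : R), 0 < eps -> exists s : seq R,
  [/\ uniq s, forall l, l \in s -> Lam l & 1 - eps < \sum_(l <- s) fourier_sq mu (x + l)].

Lemma fourier_hat_orth k l : Lam k -> Lam l -> k != l -> fourier_hat (k - l) = 0.
Proof.
move=> Lk Ll kl; have /eqP := orth Lk Ll kl.
rewrite paddr_eq0 ?sqr_ge0 // !sqrf_eq0 => /andP[/eqP c0 /eqP s0].
by rewrite /fourier_hat c0 s0.
Qed.

Lemma fourier_hat0 : fourier_hat 0 = 1.
Proof. by rewrite /fourier_hat fourier_cos0 fourier_sin0. Qed.

(** By Pythagoras, as the sum is the orthogonal projection of the exponential and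
    its terms have the squared lengths [fourier_sq mu (xi - l)]. *)
Lemma bessel_exp xi (s : seq R) : uniq s -> (forall l, l \in s -> Lam l) ->
  sqnorm mu (fun x => exponential xi x - exp_sum [seq (l, fourier_hat (xi - l)) | l <- s] x)
  = (1 - \sum_(l <- s) fourier_sq mu (xi - l))%:E.
Proof.
move=> us sL; pose c l := fourier_hat (xi - l).
have -> : (fun x => exponential xi x - exp_sum [seq (l, fourier_hat (xi - l)) | l <- s] x) =
    exp_sum ((xi, 1) :: [seq (l, - c l) | l <- s]).
  apply/funext => x; rewrite /exp_sum big_cons /= mul1r !big_map -sumrN; congr (_ + _).
  by apply: eq_bigr => l _; rewrite /= mulNr.
rewrite sqnorm_exp_sum; congr EFin.
suff -> : \sum_(p <- (xi, 1) :: [seq (l, - c l) | l <- s])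
   \sum_(r <- (xi, 1) :: [seq (l, - c l) | l <- s]) p.2 * Num.conj r.2 * fourier_hat (p.1 - r.1)
   = (1 - \sum_(l <- s) fourier_sq mu (xi - l))%:C by [].
have cc l : c l * Num.conj (c l) = (fourier_sq mu (xi - l))%:C by rewrite -sqn_conj.
rewrite big_cons [X in X + _]big_cons /= !big_map /= rmorph1 !mul1r subrr fourier_hat0.
have -> : \sum_(l <- s) 1 * Num.conj (- c l) * fourier_hat (xi - l) = - (\sum_(l <- s) fourier_sq mu (xi - l))%:C.
  by rewrite raddf_sum -sumrN; apply: eq_bigr => l _; rewrite mul1r rmorphN mulNr mulrC cc.
rewrite [X in _ + X = _]big1_seq ?addr0; last first.
  move=> l /= ls; rewrite big_cons /= rmorph1 mulr1 big_map (bigD1_seq l) //= big1_seq; last first.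
    move=> k /andP[kl ks]; rewrite fourier_hat_orth ?mulr0 //; [exact: sL|exact: sL|by rewrite eq_sym].
  rewrite subrr fourier_hat0 mulr1 addr0 rmorphN mulrNN cc.
  have -> : fourier_hat (l - xi) = Num.conj (c l) by rewrite fourier_hat_conj opprB.
  by rewrite mulNr cc addNr.
by rewrite rmorphB rmorph1.
Qed.

(** The squared distance from an exponential to the span is the defect in the
    Parseval identity at [- xi]. *)
Lemma in_closure_exponential xi : in_closure mu Lam (exponential xi).
Proof.
have mexp : cmeasurable (exponential xi).
  rewrite (_ : exponential xi = exp_sum [:: (xi, 1)]); first exact: cmeasurable_exp_sum.
  by apply/funext => x; rewrite /exp_sum big_seq1 mul1r.
split => // eps eps0; have [s [us sL par]] := parseval (- xi) eps0.
exists [seq (l, fourier_hat (xi - l)) | l <- s]; split.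
  by move=> _ /mapP[l /sL lL ->].
rewrite bessel_exp // lte_fin.
have -> : \sum_(l <- s) fourier_sq mu (xi - l) = \sum_(l <- s) fourier_sq mu (- xi + l).
  by apply: eq_bigr => l _; rewrite -fourier_sqN opprB addrC.
by move: par; lra.
Qed.

Lemma in_closure_exp_sum ps : in_closure mu Lam (exp_sum ps).
Proof.
by apply: in_closure_sum => p; exact/in_closureZ/in_closure_exponential.
Qed.
End ExponentialSums.

(** * Totality *)

(** These polynomials turn a trigonometric polynomial with values in the unit
    interval into approximations of an indicator.  With [N] the outer exponent,
    [N%:R * v ^+ n] is [n * (2 * v) ^+ n].  If [v < 2^-1] it tends to zero, and
    Bernoulli's inequality gives the limit one.  Otherwise it tends to infinity,
    and so does [(1 + v ^+ n) ^+ N], whose inverse dominates the polynomial. *)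
Lemma threshold_cvg (R : realType) (v : R) : 0 <= v <= 1 ->
  (1 - v ^+ n.+1) ^+ (n.+1 * 2 ^ n.+1) @[n --> \oo] --> (((v < 2^-1)%R)%:R : R).
Proof.
move=> /andP[v0 v1].
have bern (y : R) N : -1 <= y -> 1 + N%:R * y <= (1 + y) ^+ N.
  move=> y1; elim: N => [|N IH]; first by rewrite mul0r addr0 expr0.
  rewrite exprS -natr1.
  have := ler_wpM2l (_ : 0 <= 1 + y) IH; rewrite -lerBlDl sub0r => /(_ y1).
  have : 0 <= N%:R * (y * y) by rewrite mulr_ge0 // -expr2 sqr_ge0.
  lra.
have vn0 n : 0 <= v ^+ n.+1 by rewrite exprn_ge0.
have vn1 n : v ^+ n.+1 <= 1 by rewrite exprn_ile1.
have NE n : (n.+1 * 2 ^ n.+1)%:R * v ^+ n.+1 = n.+1%:R * (2 * v) ^+ n.+1 :> R.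
  by rewrite natrM natrX exprMn mulrA.
have [v_lt|v_ge] := ltP v 2^-1.
- have z01 : 0 <= 2 * v < 1 by lra.
  have lim : 1 - n.+1%:R * (2 * v) ^+ n.+1 @[n --> \oo] --> (1 : R).
    by rewrite -[X in _ --> X]subr0; apply: cvgB; [exact: cvg_cst|exact: cvg_natmul_geometric].
  apply: (squeeze_cvgr _ lim (cvg_cst (1 : R))); apply: nearW => n.
  apply/andP; split; last first.
    by rewrite exprn_ile1 ?subr_ge0 // lerBlDr lerDl.
  have := bern (- v ^+ n.+1) (n.+1 * 2 ^ n.+1)%N; rewrite mulrN NE; apply.
  by rewrite lerN2.
- have lim : n.+1%:R^-1 @[n --> \oo] --> (0 : R) by exact: cvg_harmonic.
  apply: (squeeze_cvgr _ (cvg_cst (0 : R)) lim); apply: nearW => n.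
  rewrite exprn_ge0 ?subr_ge0 //=; set N := (n.+1 * _)%N.
  have N1 : n.+1%:R <= (1 + v ^+ n.+1) ^+ N.
    apply: le_trans (bern _ N (le_trans _ (vn0 n))); last by lra.
    rewrite NE -[leLHS]mulr1; apply: le_trans (_ : _ <= n.+1%:R * (2 * v) ^+ n.+1) _.
      by rewrite ler_pM2l // exprn_ege1 //; lra.
    by rewrite lerDr.
  have w0 : 0 <= (1 - v ^+ n.+1) ^+ N by rewrite exprn_ge0 // subr_ge0.
  rewrite -[leRHS]mul1r ler_pdivlMr //; apply: le_trans (ler_wpM2l w0 N1) _.
  by rewrite -exprMn -subr_sqr expr1n exprn_ile1 // ?subr_ge0 ?exprn_ile1 ?sqr_ge0 ?lerBlDr ?lerDl ?sqr_ge0.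
Qed.

Section StepFunctions.
Context (R : realType) (mu : probability (measurableTypeR R) R) (Lam : set R).
Local Notation T := (measurableTypeR R).
Local Open Scope complex_scope.
Local Notation exp_sum := (@exp_sum R).
Hypothesis exp_sum_closure : forall ps, in_closure mu Lam (exp_sum ps).
Hypothesis mu_bounded : exists C : R, {ae mu, forall x : T, `|x : R| <= C}.

(** Trigonometric polynomials. *)
Definition is_exp_sum (h : T -> R[i]) := exists ps, forall x, exp_sum ps x = h x.

Lemma is_exp_sum_exponential l : is_exp_sum (exponential l).
Proof. by exists [:: (l, 1)] => x; rewrite /exp_sum big_seq1 mul1r. Qed.

Lemma is_exp_sum_cst z : is_exp_sum (fun=> z).
Proof.
exists [:: (0, z)] => x; rewrite /exp_sum big_seq1 /= /exponential mul0r expi2pi0.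
by rewrite mulr1.
Qed.

Lemma is_exp_sumD f g : is_exp_sum f -> is_exp_sum g -> is_exp_sum (fun x => f x + g x).
Proof.
by move=> [ps pf] [qs qg]; exists (ps ++ qs) => x; rewrite /exp_sum big_cat /= -pf -qg.
Qed.

Lemma is_exp_sumM f g : is_exp_sum f -> is_exp_sum g -> is_exp_sum (fun x => f x * g x).
Proof.
by move=> [ps pf] [qs qg]; exists (exp_sum_mul ps qs) => x; rewrite exp_sumM pf qg.
Qed.

Lemma is_exp_sumX f n : is_exp_sum f -> is_exp_sum (fun x => f x ^+ n).
Proof.
move=> ef; elim: n => [|n IH]; first exact: is_exp_sum_cst.
by under eq_fun do rewrite exprS; exact: is_exp_sumM.
Qed.

Lemma is_exp_sum_Re f : is_exp_sum f -> is_exp_sum (fun x => (complex.Re (f x))%:C).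
Proof.
move=> ef; have ec : is_exp_sum (fun x => Num.conj (f x)).
  by case: ef => ps pf; exists (exp_sum_conj ps) => x; rewrite exp_sum_conjE pf.
rewrite (_ : (fun x => _) = fun x => (2^-1 : R)%:C * (f x + Num.conj (f x))).
  by apply: is_exp_sumM; [exact: is_exp_sum_cst|exact: is_exp_sumD].
apply/funext => x; case: (f x) => u v; apply/eqP; rewrite eq_complex /=.
by apply/andP; split; apply/eqP; field.
Qed.

Lemma is_exp_sum_closure h : is_exp_sum h -> in_closure mu Lam h.
Proof.
by move=> [ps ph]; rewrite (_ : h = exp_sum ps) //; apply/funext => x; rewrite ph.
Qed.

Lemma is_exp_sum_sin (P a : R) : P != 0 ->
  is_exp_sum (fun x : T => (sin (2 * pi * ((x - a) / P)))%:C).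
Proof.
move=> P0; have h : is_exp_sum (fun x : T => (- 'i * expi2pi (- a / P)) * exponential P^-1 x).
  by apply: is_exp_sumM; [exact: is_exp_sum_cst|exact: is_exp_sum_exponential].
have := is_exp_sum_Re h; congr is_exp_sum; apply/funext => x.
rewrite -mulrA /exponential -expi2piD (_ : - a / P + P^-1 * x = (x - a) / P); last by ring.
by apply/eqP; rewrite eq_complex /= !eqxx andbT; apply/eqP; ring.
Qed.

Definition indic_closure (A : set T) := in_closure mu Lam (fun x => (\1_A x : R)%:C).

(** On an interval around [a] that carries the measure and is shorter than the
    period [P], the sign of the sine decides on which side of [a] a point lies.
    Thresholding the sine gives the indicator, boundedly. *)
Lemma half_line_closure (a : R) : indic_closure [set` `]-oo, a[%R].
Proof.
have [C aeC] := mu_bounded.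
pose P := 2 * (`|C| + `|a|) + 2.
have P0 : 0 < P by have := normr_ge0 C; have := normr_ge0 a; rewrite /P; lra.
pose v (x : T) : R := (1 + sin (2 * pi * ((x - a) / P))) / 2.
have v01 x : 0 <= v x <= 1.
  have := sin_geN1 (2 * pi * ((x - a) / P)); have := sin_le1 (2 * pi * ((x - a) / P)).
  by rewrite /v; lra.
have ev : is_exp_sum (fun x => (v x)%:C).
  rewrite (_ : (fun x => _) = fun x : T => (2^-1 : R)%:C * (1 + (sin (2 * pi * ((x - a) / P)))%:C)).
    apply: is_exp_sumM; first exact: is_exp_sum_cst.
    by apply: is_exp_sumD; [exact: is_exp_sum_cst|apply: is_exp_sum_sin; rewrite gt_eqF].
  by apply/funext => x; rewrite -rmorphD -rmorphM /v mulrC.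
pose w n (x : T) : R := (1 - v x ^+ n.+1) ^+ (n.+1 * 2 ^ n.+1).
have ew n : is_exp_sum (fun x => (w n x)%:C).
  rewrite (_ : (fun x => _) = fun x : T => (1 + (-1 : R)%:C * (v x)%:C ^+ n.+1) ^+ (n.+1 * 2 ^ n.+1)).
    apply: is_exp_sumX; apply: is_exp_sumD; first exact: is_exp_sum_cst.
    by apply: is_exp_sumM; [exact: is_exp_sum_cst|exact: is_exp_sumX].
  by apply/funext => x; rewrite -rmorphXn -rmorphM -rmorphD -rmorphXn mulN1r.
have w01 n x : 0 <= w n x <= 1.
  have /andP[v0 v1] := v01 x.
  by rewrite exprn_ge0 ?exprn_ile1 // ?subr_ge0 ?exprn_ile1 // lerBlDr lerDl exprn_ge0.
pose I (x : T) : R := \1_([set` `]-oo, a[%R]) x.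
have sqnI n x : sqn ((I x)%:C - (w n x)%:C) = (I x - w n x) ^+ 2.
  by rewrite -rmorphB /sqn /= expr0n addr0.
apply: (@in_closure_dominated _ mu Lam (fun n x => (w n x)%:C) _ (cst 1)).
- by move=> n; exact: is_exp_sum_closure.
- apply: cmeasurable_real; apply: measurable_indic; exact: measurable_itv.
- exact: bounded_measurable_integrable (bounded_measurable_cst 1).
- apply: filterS aeC => x xC.
  have -> : (fun n => sqn ((I x)%:C - (w n x)%:C)) = fun n => (I x - w n x) ^+ 2.
    by apply/funext => n; exact: sqnI.
  have -> : (0 : R) = (I x - ((v x < 2^-1)%R)%:R) ^+ 2.
    suff -> : I x = ((v x < 2^-1)%R)%:R by rewrite subrr expr0n.
    rewrite /I indicE mem_setE in_itv /=; congr (_%:R); congr nat_of_bool.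
    have -> : (v x < 2^-1) = (sin (2 * pi * ((x - a) / P)) < 0).
      by rewrite /v; apply/idP/idP; lra.
    have xa : `|x - a| < P / 2.
      apply: le_lt_trans (ler_normB _ _) _.
      by have := ler_norm C; rewrite /P; lra.
    move: xa; rewrite ltr_norml => /andP[xa1 xa2].
    have pi0 := pi_gt0 R.
    have angle : 2 * pi * ((x - a) / P) = pi * ((x - a) / (P / 2)) by field; rewrite gt_eqF.
    have P2 : 0 < P / 2 by rewrite divr_gt0.
    rewrite angle; have [xlt|xge] := ltP x a.
      rewrite -oppr_gt0 -sinN sin_gt0_pi // -mulrN -mulNr.
      rewrite mulr_gt0 ?divr_gt0 ?oppr_gt0 ?subr_lt0 //= -[ltRHS]mulr1 ltr_pM2l //.
      by rewrite ltr_pdivrMr // mul1r; lra.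
    apply/esym/negbTE; rewrite -leNgt sin_ge0_pi //.
    apply/andP; split.
      by rewrite mulr_ge0 ?divr_ge0 ?subr_ge0 // ltW.
    by rewrite ler_piMr ?(ltW pi0) // ler_pdivrMr // mul1r ltW.
  under eq_fun do rewrite expr2; rewrite expr2.
  by apply: cvgM; apply: cvgB; try exact: cvg_cst; exact: threshold_cvg.
- move=> n x; rewrite sqnI; have /andP[w0 w1] := w01 n x.
  have : 0 <= I x <= 1 by rewrite /I indicE; case: (_ \in _); rewrite /= ?lexx ler01.
  rewrite /=; nra.
Qed.

Lemma indic_closureC A : measurable A -> indic_closure A -> indic_closure (~` A).
Proof.
move=> mA cA; have c1 : in_closure mu Lam (fun=> 1).
  exact: is_exp_sum_closure (is_exp_sum_cst 1).
have := in_closureD c1 (in_closureZ (-1) cA); congr in_closure; apply/funext => x.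
rewrite !indicE in_setC; case: (x \in A) => /=.
  by rewrite rmorph1 mulr1 addrN.
by rewrite rmorph0 mulr0 addr0.
Qed.

Lemma indic_closure_bigcup (F : (set T)^nat) : (forall n, measurable (F n)) ->
  trivIset [set: nat] F -> (forall n, indic_closure (F n)) ->
  indic_closure (\bigcup_k F k).
Proof.
move=> mF tF cF; set A := \bigcup_k F k.
pose S n (x : T) : R := \sum_(k < n) \1_(F k) x.
have SE x : (A x /\ exists k, forall n, S n x = ((k < n)%N)%:R) \/
    (~ A x /\ forall n, S n x = 0).
  have [[k _ Fkx]|nA] := pselect (A x); [left|right]; last first.
    split => // n; rewrite /S big1 // => k _; rewrite indicE memNset // => Fkx.
    by apply: nA; exists k.
  split; [by exists k|exists k => n].
  have e j : \1_(F j) x = (j == k)%:R :> R.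
    rewrite indicE; have [->|jk] := eqVneq j k; first by rewrite mem_set.
    rewrite memNset // => Fjx; move/eqP: jk; apply.
    by apply: (tF j k) => //; exists x.
  rewrite /S; under eq_bigr do rewrite e; have [kn|nk] := ltnP k n.
    rewrite (bigD1 (Ordinal kn)) //= eqxx big1 ?addr0 // => i /negbTE ik.
    by rewrite -[LHS]/((i == Ordinal kn)%:R) ik.
  by rewrite big1 // => i _; rewrite ltn_eqF // (leq_trans _ nk).
apply: (@in_closure_dominated _ mu Lam (fun n x => (S n x)%:C) _ (cst 1)).
- move=> n; rewrite (_ : (fun x => _) = fun x => \sum_(k < n) (\1_(F k) x : R)%:C).
    apply: (@in_closure_sum _ mu Lam _ _ (fun (k : 'I_n) x => (\1_(F k) x : R)%:C)) => k.
    exact: cF.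
  by apply/funext => x; rewrite rmorph_sum.
- apply: cmeasurable_real; apply: measurable_indic; exact: bigcup_measurable.
- exact: bounded_measurable_integrable (bounded_measurable_cst 1).
- apply: aeW => x; case: (SE x) => [[Ax [k Sk]]|[nAx S0]]; apply: cvg_near_cst.
    exists k.+1 => // n /= kn.
    by rewrite Sk kn indicE mem_set // subrr /sqn /= expr0n addr0.
  by apply: nearW => n; rewrite S0 indicE memNset // subrr /sqn /= expr0n addr0.
- move=> n x; rewrite -rmorphB /sqn /= expr0n addr0 indicE.
  case: (SE x) => [[Ax [k ->]]|[nAx ->]]; last by rewrite memNset // subrr expr0n ler01.
  by rewrite mem_set //; case: (k < n)%N; rewrite ?subrr ?subr0 ?expr1n ?expr0n ?ler01.
Qed.

Lemma measurable_indic_closure (A : set T) : measurable A -> indic_closure A.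
Proof.
move=> mA.
suff: forall S, <<s @RGenInftyO.G R >> S -> indic_closure S.
  by apply; move: mA; rewrite [X in X A -> _]RGenInftyO.measurableE.
apply: (dynkin_induction (RGenInftyO.measurableE R)).
- move=> _ _ [x ->] [y ->]; exists (Num.min x y).
  by apply/seteqP; split => z /=; rewrite !in_itv /= lt_min => /andP.
- have := is_exp_sum_closure (is_exp_sum_cst 1); congr in_closure; apply/funext => x.
  by rewrite indicT.
- by move=> _ [a ->]; exact: half_line_closure.
- exact: indic_closureC.
- exact: indic_closure_bigcup.
Qed.

Lemma nnsfun_closure (h : {nnsfun T >-> R}) : in_closure mu Lam (fun x => (h x)%:C).
Proof.
rewrite (_ : (fun x => _) = fun x => \sum_(i < #|` fset_set (range h)|%fset)
   ((fset_set (range h))`_i)%:C * (\1_(h @^-1` [set (fset_set (range h))`_i]) x : R)%:C).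
  by apply: in_closure_sum => i; apply: in_closureZ; exact: measurable_indic_closure.
by apply/funext => x; rewrite fimfunEord rmorph_sum; apply: eq_bigr => i _; rewrite rmorphM.
Qed.

Lemma nonneg_closure (h : T -> R) : measurable_fun [set: T] h -> (forall x, 0 <= h x) ->
  (\int[mu]_x ((h x) ^+ 2)%:E < +oo)%E -> in_closure mu Lam (fun x => (h x)%:C).
Proof.
move=> mh h0 hfin.
have mh' : measurable_fun [set: T] (EFin \o h) by exact/measurable_EFinP.
pose a := nnsfun_approx measurableT mh'.
have cva x : a n x @[n --> \oo] --> h x.
  have f0 y : [set: T] y -> (0 <= (EFin \o h) y)%E by rewrite /= lee_fin.
  by have /fine_cvgP[] := cvg_nnsfun_approx measurableT mh' f0 (I : [set: T] x).
have ale n x : a n x <= h x.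
  rewrite -(cvg_lim (@Rhausdorff _) (cva x)).
  apply: (nondecreasing_cvgn_le (u_ := fun n => a n x)); last by apply: cvgP (cva x).
  by move=> i k ik; exact/lefP/nd_nnsfun_approx.
apply: (@in_closure_dominated _ mu Lam (fun n x => (a n x)%:C) _ (fun x => h x ^+ 2)).
- by move=> n; exact: nnsfun_closure.
- exact: cmeasurable_real.
- apply/integrableP; split; first by apply/measurable_EFinP; exact: measurable_funX.
  by under eq_integral do rewrite /= ger0_norm ?sqr_ge0 //.
- apply: aeW => x; under eq_fun do rewrite -rmorphB /sqn /= expr0n addr0.
  rewrite (_ : 0 = (h x - h x) * (h x - h x)); last by rewrite subrr mulr0.
  under eq_fun do rewrite expr2.
  by apply: cvgM; apply: cvgB => //; exact: cvg_cst.
- move=> n x; rewrite -rmorphB /sqn /= expr0n addr0.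
  have : 0 <= a n x by []. 
  by have := ale n x; nra.
Qed.

Lemma real_closure (h : T -> R) : measurable_fun [set: T] h ->
  (\int[mu]_x ((h x) ^+ 2)%:E < +oo)%E -> in_closure mu Lam (fun x => (h x)%:C).
Proof.
move=> mh hfin.
have part (u : T -> R) : measurable_fun [set: T] u -> (forall x, u x ^+ 2 = h x ^+ 2) ->
    in_closure mu Lam (fun x => (Num.max (u x) 0)%:C).
  move=> mu_ uh; have mm : measurable_fun [set: T] (fun x => Num.max (u x) 0).
    exact: measurable_maxr.
  apply: nonneg_closure => //; first by move=> x; rewrite le_max lexx orbT.
  apply: le_lt_trans hfin; apply: ge0_le_integral => //.
  - by move=> x _; rewrite lee_fin sqr_ge0.
  - by apply/measurable_EFinP; exact: measurable_funX.
  - by apply/measurable_EFinP; exact: measurable_funX.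
  - move=> x _; rewrite lee_fin -uh.
    by case: (leP (u x) 0) => _ //; rewrite expr0n sqr_ge0.
have mN : measurable_fun [set: T] (fun x => - h x) by exact: measurableT_comp.
have pos := part h mh (fun=> erefl).
have neg := part (fun x => - h x) mN (fun x => sqrrN (h x)).
have := in_closureD pos (in_closureZ (-1) neg); congr in_closure; apply/funext => x.
rewrite mulN1r -rmorphB; congr (_%:C).
by case: (leP (h x) 0) => h0; case: (leP (- h x) 0) => h1; lra.
Qed.

Lemma Lfun2_closure (h : T -> R) : h \in Lfun mu 2%:E -> in_closure mu Lam (fun x => (h x)%:C).
Proof.
move=> h2; have mh : measurable_fun [set: T] h by have := sub_Lfun_mfun h2; rewrite inE.
apply: real_closure => //; have /integrableP[_] := Lfun2_integrable_sqr h2.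
congr (_ < _)%E; apply: eq_integral => x _.
by rewrite /= ger0_norm // sqr_ge0.
Qed.

Lemma L2_closure (f : T -> R[i]) : complex_L2 mu f -> in_closure mu Lam f.
Proof.
move=> [/Lfun2_closure re /Lfun2_closure im].
have := in_closureD re (in_closureZ 'i im); congr in_closure; apply/funext => x.
by rewrite [RHS]complexE.
Qed.

Lemma in_closure_total : (forall f, complex_L2 mu f -> in_closure mu Lam f) ->
  total_exponentials mu Lam.
Proof.
move=> cl f /cl[mf cf] eps eps0.
have [ps [psL lt]] := cf _ (exprn_gt0 2 eps0).
exists (undup (map fst ps)), (fun l => \sum_(p <- ps | p.1 == l) p.2); split.
  by move=> l; rewrite mem_undup => /mapP[p /psL pL ->].
have e x : \sum_(l <- undup (map fst ps)) (\sum_(p <- ps | p.1 == l) p.2) * exponential l x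
    = exp_sum ps x.
  under eq_bigr do rewrite mulr_suml.
  rewrite (exchange_big_dep xpredT) //= /exp_sum [LHS]big_seq [RHS]big_seq.
  apply: eq_bigr => p pps; rewrite (eq_bigl (pred1 p.1)); last by move=> l; rewrite /= eq_sym.
  by rewrite -big_filter filter_pred1_uniq ?undup_uniq ?mem_undup ?map_f // big_seq1.
have -> : (fun x => f x - \sum_(l <- undup (map fst ps)) (\sum_(p <- ps | p.1 == l) p.2)
     * exponential l x) = fun x => f x - exp_sum ps x.
  by apply/funext => x; rewrite e.
rewrite /L2_norm unlock.
have -> : (\int[mu]_x (`|(ComplexField.Normc.normc (f x - exp_sum ps x))%:E| `^ 2)
    = sqnorm mu (fun x => (f x - exp_sum ps x)%R))%E.
  apply: eq_integral => x _; case: (f x - exp_sum ps x) => u v.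
  rewrite /= /sqn /= ger0_norm ?sqrtr_ge0 // powR_mulrn ?sqrtr_ge0 //.
  by rewrite sqr_sqrtr ?addr_ge0 ?sqr_ge0.
move: lt; have := sqnorm_ge0 mu (fun x => f x - exp_sum ps x); case: (sqnorm _ _) => [r| |] //.
rewrite lee_fin lte_fin => r0 lt; rewrite poweR_EFin lte_fin powR12_sqrt //.
by rewrite -[eps](gtr0_norm eps0) -sqrtr_sqr ltr_sqrt // exprn_gt0.
Qed.
End StepFunctions.

Lemma L2_inner_exponential (R : realType) (mu : probability (measurableTypeR R) R) (l m : R) :
  L2_inner mu (exponential l) (exponential m) = fourier_hat mu (l - m).
Proof.
have e : (fun x => exponential l x * (exponential m x)^*) =
    (fun x => exponential (l - m) x) :> (measurableTypeR R -> R[i]).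
  apply/funext => x; rewrite exponentialD; congr (_ * _).
  by rewrite /exponential mulNr -expi2pi_conj.
rewrite /L2_inner /fourier_hat; congr (_ +i* _)%C; congr Rintegral; apply/funext => x.
  by rewrite -[LHS]/(complex.Re ((fun x => exponential l x * (exponential m x)^*) x)) e /= mulrA.
by rewrite -[LHS]/(complex.Im ((fun x => exponential l x * (exponential m x)^*) x)) e /= mulrA.
Qed.

(** The criterion of Jorgensen and Pedersen: for an orthogonal family, the
    Parseval identity for the exponentials implies totality, because the
    exponentials span a dense subspace. *)
Lemma is_spectrum_criterion (R : realType) (mu : probability (measurableTypeR R) R) (Lam : set R)
    (mu_bounded : exists C : R, {ae mu, forall x : measurableTypeR R, `|x : R| <= C})
    (countL : countable Lam)
    (orth : forall k l, Lam k -> Lam l -> k != l -> fourier_sq mu (k - l) = 0)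
    (parseval : forall x (eps : R), 0 < eps -> exists s : seq R,
      [/\ uniq s, forall l, l \in s -> Lam l & 1 - eps < \sum_(l <- s) fourier_sq mu (x + l)]) :
  is_spectrum mu Lam.
Proof.
split => //; last first.
  apply: in_closure_total => f; apply: L2_closure => //.
  exact: in_closure_exp_sum orth parseval.
move=> l m Ll Lm; rewrite L2_inner_exponential.
have [->|lm] := eqVneq l m; first by rewrite subrr fourier_hat0.
by rewrite (fourier_hat_orth orth).
Qed.

Lemma ae_bounded (R : realType) (b : int) (D : {fset int})
    (mu : probability (measurableTypeR R) R) : self_similar_measure b D mu ->
  exists C : R, {ae mu, forall x : measurableTypeR R, `|x : R| <= C}.
Proof.
move=> hmu; have [C [_ muS]] := exists_support_interval hmu; exists C.
have mS : measurable (`[- C, C]%classic : set (measurableTypeR R)) by exact: measurable_itv.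
exists (~` `[- C, C]%classic); split.
- exact: measurableC.
- by rewrite probability_setC // muS subee.
- by move=> x /= nx; apply: contra_not nx; rewrite in_itv /= -ler_norml.
Qed.

Theorem theorem1p3 (R : realType) (b : int) (q : nat) (D : {fset int})
    (hq : (2 <= q)%N) (hqb : q%:Z < b)
    (hD0 : 0 \in D) (hDq : #|` D|%fset = q)
    (hL : exists L : {fset int}, hadamard_triple R b D L)
    (mu : probability (measurableTypeR R) R)
    (hmu : self_similar_measure b D mu)
    (t : R) (ht0 : 0 < t) (ht1 : t < ln (q%:R : R) / ln (b%:~R : R))
    (s : \bar R) (hs : (0 <= s)%E) :
  exists Lambda : set R,
    [/\ is_spectrum mu Lambda,
        beurling_dim Lambda = t%:E &
        upper_beurling_density t Lambda = s].
Proof.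
case: b hqb hL hmu ht1 => [b|//] qb [L hL] hmu ht1.
have {}qb : (q < b)%N by [].
have [g0 [K [Ls dat]]] := self_similar_data hq qb hD0 hDq hL hmu.
have btq : (b%:R : R) `^ t < q%:R.
  have b1 : 1 < b%:R :> R by rewrite ltr1n (leq_trans hq (ltnW qb)).
  have q0 : 0 < q%:R :> R by rewrite ltr0n (leq_trans _ hq).
  have b0 : 0 < b%:R :> R by apply: lt_trans b1.
  rewrite -ltr_ln ?posrE ?powR_gt0 // ln_powR.
  by rewrite -ltr_pdivlMr // ln_gt0.
have [c [c0 target]] := exists_targets ht0 hs.
have [kap [Lam [kap0 prof orth parseval]]] := exists_profiled_spectrum dat ht0 btq c0.
have [dim dens] := target _ _ kap0 prof.
exists (\bigcup_n [set` Lam n]); split => //.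
apply: is_spectrum_criterion (ae_bounded hmu) _ _ _.
- by apply: bigcup_countable => // n _; exact: finite_set_countable.
- move=> k l [i _ ki] [j _ lj] kl; apply: (orth (maxn i j)) => //.
    by apply: (dp_sub prof) lj; exact: leq_maxr.
  by apply: (dp_sub prof) ki; exact: leq_maxl.
- move=> x eps /(parseval x)[n lt]; exists (Lam n); split => //.
    exact: (dp_uniq prof).
  by move=> l ll; exists n.
Qed.
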